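(* Fix a time step $k$. Suppose the forward filtered distribution is $$p(x_k,z_k\mid y_{1:k})=\sum_{i=1}^{M^{\mathrm f}_k} w^i_{k|k}(z_k)\,\mathcal N\big(x_k\mid \mu^i_{k|k}(z_k),\mathbf P^i_{k|k}(z_k)\big),$$ the backward likelihood is $$p(y_{k+1:N}\mid x_{k+1},z_{k+1})=\sum_{\ell=1}^{M^{\mathrm c}_{k+1}}\mathcal L\big(x_{k+1}\mid \bar r^\ell_{k+1}(z_{k+1}),\bar s^\ell_{k+1}(z_{k+1}),\bar{\mathbf L}^\ell_{k+1}(z_{k+1})\big),$$ and the hybrid transition model is $$p(x_{k+1},z_{k+1}\mid x_k,z_k)=\mathbf T(z_{k+1},z_k)\,\mathcal N\big(x_{k+1}\mid \mathbf A_k(z_k)x_k+b_k(z_k),\mathbf Q_k(z_k)\big).$$ Then the joint smoothed distribution is $$p(x_{k+1},z_{k+1},x_k,z_k\mid y_{1:N})=\sum_{j=1}^{M^{\mathrm S}_k} w^j_{k:k+1|N}(z_k,z_{k+1})\,\mathcal N\left(\begin{bmatrix} x_k \\ x_{k+1} \end{bmatrix}\Big|\ \mu^j_{k:k+1|N}(z_k,z_{k+1}),\ \mathbf P^j_{k:k+1|N}(z_k,z_{k+1})\right),$$ where $M^{\mathrm S}_k=M^{\mathrm f}_k\cdot M^{\mathrm c}_{k+1}$, the index $j=M^{\mathrm f}_k(\ell-1)+i$ enumerates the pairs $(i,\ell)$ with $1\le i\le M^{\mathrm f}_k$, $1\le \ell\le M^{\mathrm c}_{k+1}$, and, for each such $j\leftrightarrow(i,\ell)$: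 $$w^j_{k:k+1|N}(z_k,z_{k+1})=\frac{\tilde w^j_{k:k+1|N}(z_k,z_{k+1})}{\sum_{z_{k+1}=1}^m\sum_{z_k=1}^m\sum_{p=1}^{M^{\mathrm S}_k}\tilde w^p_{k:k+1|N}(z_k,z_{k+1})},\qquad \tilde w^j_{k:k+1|N}(z_k,z_{k+1})=e^{\frac12\beta^j(z_k,z_{k+1})},$$ $$\begin{aligned}\beta^j(z_k,z_{k+1})={}&(\mu^j_{k:k+1|N}(z_k,z_{k+1}))^T(\mathbf P^j_{k:k+1|N}(z_k,z_{k+1}))^{-1}\mu^j_{k:k+1|N}(z_k,z_{k+1})+2\ln w^i_{k|k}(z_k)+2\ln\mathbf T(z_{k+1},z_k) \\ &-(\mu^i_{k:k+1|k}(z_k))^T(\mathbf P^i_{k:k+1|k}(z_k))^{-1}\mu^i_{k:k+1|k}(z_k)-\bar r^\ell_{k+1}(z_{k+1}) \\ &+\ln|\mathbf P^j_{k:k+1|N}(z_k,z_{k+1})|-\ln|\mathbf P^i_{k:k+1|k}(z_k)|,\end{aligned}$$ $$\mu^j_{k:k+1|N}(z_k,z_{k+1})=\mathbf P^j_{k:k+1|N}(z_k,z_{k+1})\left((\mathbf P^i_{k:k+1|k}(z_k))^{-1}\mu^i_{k:k+1|k}(z_k)-\begin{bmatrix}\vec 0_{n_x} \\ \bar s^\ell_{k+1}(z_{k+1})\end{bmatrix}\right),$$ $$\mu^i_{k:k+1|k}(z_k)=\begin{bmatrix}\mu^i_{k|k}(z_k) \\ \mathbf A_k(z_k)\mu^i_{k|k}(z_k)+b_k(z_k)\end{bmatrix}.$$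 A square-root factor of the joint-smoothed covariance is $(\mathbf P^j_{k:k+1|N}(z_k,z_{k+1}))^{1/2}=\mathcal R_{22}$, where $\mathcal R_{22}$ is the lower-right $2n_x\times 2n_x$ block of the upper triangular factor in the QR decomposition $$\begin{bmatrix}\mathcal R_{11}&\mathcal R_{12} \\ \mathbf 0&\mathcal R_{22}\end{bmatrix}=\boldsymbol{\mathcal Q}\begin{bmatrix}\mathbf I_{2n_x}&\mathbf 0_{2n_x} \\ \mathbf J^j_k(z_k,z_{k+1})&(\mathbf P^i_{k:k+1|k}(z_k))^{1/2}\end{bmatrix},$$ with $$(\mathbf P^i_{k:k+1|k}(z_k))^{1/2}=\begin{bmatrix}(\mathbf P^i_{k|k}(z_k))^{1/2}&(\mathbf P^i_{k|k}(z_k))^{1/2}\mathbf A_k^T(z_k) \\ \mathbf 0_{n_x}&\mathbf Q_k^{1/2}(z_k)\end{bmatrix},$$ $$\mathbf J^j_k(z_k,z_{k+1})=\begin{bmatrix}\mathbf 0_{n_x}&(\mathbf P^i_{k|k}(z_k))^{1/2}\mathbf A_k^T(z_k)\big((\bar{\mathbf L}^\ell_{k+1}(z_{k+1}))^{1/2}\big)^T \\ \mathbf 0_{n_x}&\mathbf Q_k^{1/2}(z_k)\big((\bar{\mathbf L}^\ell_{k+1}(z_{k+1}))^{1/2}\big)^T\end{bmatrix}.$$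
   Context: Setting: a hybrid (jump Markov linear) state-space model with continuous states $x_k\in\mathbb R^{n_x}$, discrete modes $z_k\in\{1,\dots,m\}$ and observations $y_1,\dots,y_N\in\mathbb R^{n_y}$; $y_{a:b}=(y_a,\dots,y_b)$. The pair $(x_k,z_k)$ is a Markov state: conditionally on $x_{1:k},z_{1:k},y_{1:k}$, the pair $(x_{k+1},z_{k+1})$ has the density given by the hybrid transition model in the claim (the known quantities $\mathbf A_k(z),b_k(z),\mathbf Q_k(z)$ may depend on known inputs and on the already recorded value $y_k$), and conditionally on $x_{1:k+1},z_{1:k+1},y_{1:k}$, the future observations $y_{k+1:N}$ depend only on $(x_{k+1},z_{k+1})$. $\mathbf T(j,i)=\mathbb P(Z_{k+1}=j\mid Z_k=i)$ is the mode transition matrix (each column sums to 1). Densities such as $p(x_k,z_k\mid y_{1:k})$ are densities with respect to Lebesgue measure times counting measure. $\mathcal N(x\mid\mu,\mathbf P)$ is the Gaussian density with mean $\mu$ and covariance $\mathbf P$; all covariances $\mathbf P^i_{k|k}(z)$, $\mathbf Q_k(z)$ are symmetric positive definite, the matrices $\bar{\mathbf L}^\ell_{k+1}(z)$ are symmetric positive semidefinite, and weights are nonnegative (with the convention $\ln 0=-\infty$, $e^{-\infty}=0$). The quadratic likelihood function is $\mathcal L(x\mid r,s,\mathbf L)=e^{-\frac12(r+2x^Ts+x^T\mathbf Lx)}$ with $r\in\mathbb R$, $s\in\mathbb R^{n_x}$, $\mathbf L\in\mathbb R^{n_x\times n_x}$. $A^{1/2}$ denotes an (upper triangular) square-root factor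 of $A$, i.e. $(A^{1/2})^TA^{1/2}=A$. In a ''Q-less QR decomposition'' $\boldsymbol{\mathcal R}=\boldsymbol{\mathcal Q}\,X$, $\boldsymbol{\mathcal Q}$ is an orthogonal matrix for which the result $\boldsymbol{\mathcal R}$ is upper triangular. $\mathbf I_n$, $\mathbf 0_n$ are the $n\times n$ identity and zero matrices; $\vec 0_n$ is the zero column vector of length $n$; $|\cdot|$ of a matrix is the determinant. $(\mathbf P^i_{k:k+1|k}(z_k))^{1/2}$ in the claim defines $\mathbf P^i_{k:k+1|k}(z_k)$ through $\mathbf P=(\mathbf P^{1/2})^T\mathbf P^{1/2}$. *)

(* Defs.v *)
From HB Require Import structures.
From mathcomp Require Import all_boot all_order all_algebra.
From mathcomp Require Import all_classical all_reals all_analysis.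
From mathcomp Require Import measurable_realfun random_variable.

Set Implicit Arguments.
Unset Strict Implicit.
Unset Printing Implicit Defensive.

Import Order.TTheory GRing.Theory Num.Theory.
Import numFieldTopology.Exports.

Local Open Scope classical_set_scope.
Local Open Scope ring_scope.

(** * Borel structure and Lebesgue measure on column vectors *)

Definition measure_matrix_display : measure_display -> measure_display.
Proof. exact. Qed.

(* Matrices carry the sigma-algebra generated by their entries. *)
Section measurable_matrix.
Context {R : realType} (m n : nat).

Definition mx_entry_sets : set (set 'M[R]_(m, n)) :=
  \bigcup_(ij in [set: 'I_m * 'I_n])
    preimage_set_system [set: 'M[R]_(m, n)] (fun M => M ij.1 ij.2) measurable.

Let mx0 : <<s mx_entry_sets >> set0.
Proof. exact: sigma_algebra0. Qed.

Let mxC A : <<s mx_entry_sets >> A -> <<s mx_entry_sets >> (~` A).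
Proof. exact: sigma_algebraC. Qed.

Let mxU (F : (set 'M[R]_(m, n))^nat) :
  (forall i, <<s mx_entry_sets >> (F i)) ->
  <<s mx_entry_sets >> (\bigcup_i (F i)).
Proof. exact: sigma_algebra_bigcup. Qed.

HB.instance Definition _ := @isMeasurable.Build
  (measure_matrix_display default_measure_display) 'M[R]_(m, n)
  <<s mx_entry_sets >> mx0 mxC mxU.

End measurable_matrix.

Section modes.
Context (m : nat).

HB.instance Definition _ := isPointed.Build 'I_m.+1 ord0.

HB.instance Definition _ := @isMeasurable.Build default_measure_display
  'I_m.+1 discrete_measurable (@discrete_measurable0 _)
  (@discrete_measurableC _) (@discrete_measurableU _).

Context {R : realType}.

Let mode_counting_fin : fin_num_fun (@counting 'I_m.+1 R).
Proof.
move=> A _; rewrite /counting asboolT//.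
exact: (sub_finite_set (@subsetT _ A) (@finite_finset _ [set: 'I_m.+1])).
Qed.

HB.instance Definition _ :=
  Measure_isFinite.Build _ _ _ (@counting 'I_m.+1 R) mode_counting_fin.

End modes.

Section sigma_finite.
Context d1 d2 (T1 : measurableType d1) (T2 : measurableType d2) (R : realType).
Local Open Scope ereal_scope.

Lemma sigma_finite_prod (mu : {sigma_finite_measure set T1 -> \bar R})
    (nu : {sigma_finite_measure set T2 -> \bar R}) :
  sigma_finite setT (mu \x nu).
Proof.
have /sigma_finiteP[F [TF ndF Foo]] := sigma_finiteT mu.
have /sigma_finiteP[G [TG ndG Goo]] := sigma_finiteT nu.
exists (fun n => F n `*` G n).
  rewrite -setXTT TF TG predeqE => -[x y]; split.
    move=> [/= [n _ Fnx] [k _ Gky]]; exists (maxn n k) => //; split.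
    - by move: x Fnx; exact/subsetPset/ndF/leq_maxl.
    - by move: y Gky; exact/subsetPset/ndG/leq_maxr.
  by move=> [n _ []/= ? ?]; split; exists n.
move=> k; have [? ?] := Foo k; have [? ?] := Goo k.
split; first exact: measurableX.
by rewrite product_measure1E// lte_mul_pinfty// ge0_fin_numE.
Qed.

Lemma sigma_finite_pushforward (mu : set T1 -> \bar R) (f : T1 -> T2)
    (g : T2 -> T1) :
  measurable_fun setT g -> cancel f g -> sigma_finite setT mu ->
  sigma_finite setT (pushforward mu f).
Proof.
move=> mg fK [F FT mF]; exists (fun i => g @^-1` F i).
  apply/seteqP; split => // t _.
  have : setT (g t) by [].
  by rewrite FT => -[i _ Fi]; exists i.
move=> i; have [mFi Fioo] := mF i; split.
  by rewrite -[X in measurable X]setTI; exact: mg.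
rewrite /pushforward (_ : _ @^-1` _ = F i)//.
by apply/seteqP; split => p /=; rewrite fK.
Qed.

End sigma_finite.

Section tuple_measure.
Context d (T : measurableType d) (R : realType).

Definition cons_pair n (p : T * n.-tuple T) : n.+1.-tuple T :=
  [tuple of p.1 :: p.2].

Definition uncons n (t : n.+1.-tuple T) : T * n.-tuple T :=
  (thead t, [tuple of behead t]).

Lemma measurable_cons_pair n : measurable_fun setT (@cons_pair n).
Proof. exact: measurable_cons. Qed.

Lemma measurable_uncons n : measurable_fun setT (@uncons n).
Proof.
apply: measurable_fun_pair; last exact: measurable_behead.
exact: measurable_tnth.
Qed.

Lemma cons_pairK n : cancel (@cons_pair n) (@uncons n).
Proof. by move=> [x t]; congr pair; apply/val_inj. Qed.

Definition cons_measure (mu : {sigma_finite_measure set T -> \bar R}) n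
    (nu : {sigma_finite_measure set (n.-tuple T) -> \bar R}) :=
  pushforward (mu \x nu)%E (@cons_pair n).

Section cons_measure.
Variables (mu : {sigma_finite_measure set T -> \bar R}) (n : nat).
Variable nu : {sigma_finite_measure set (n.-tuple T) -> \bar R}.
Local Open Scope ereal_scope.

Let push : {measure set (n.+1.-tuple T) -> \bar R} :=
  measure_function_pushforward__canonical__measure_function_Measure
    (mu \x nu) (@measurable_cons_pair n).

Let cons0 : cons_measure mu nu set0 = 0.
Proof. exact: (measure0 push). Qed.

Let cons_ge0 A : 0 <= cons_measure mu nu A.
Proof. exact: (measure_ge0 push). Qed.

Let cons_sigma_additive : semi_sigma_additive (cons_measure mu nu).
Proof. exact: (@measure_semi_sigma_additive _ _ _ push). Qed.

HB.instance Definition _ := isMeasure.Build _ _ _ (cons_measure mu nu)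
  cons0 cons_ge0 cons_sigma_additive.

Let cons_sigma_finite : sigma_finite setT (cons_measure mu nu).
Proof.
apply: sigma_finite_pushforward; first exact: measurable_uncons.
  exact: cons_pairK.
exact: sigma_finite_prod.
Qed.

HB.instance Definition _ := Measure_isSigmaFinite.Build _ _ _
  (cons_measure mu nu) cons_sigma_finite.

End cons_measure.

(* The n-fold product of mu. *)
Fixpoint tuple_measure (mu : {sigma_finite_measure set T -> \bar R}) n :
    {sigma_finite_measure set (n.-tuple T) -> \bar R} :=
  match n with
  | 0 => dirac [tuple]
  | n'.+1 => cons_measure mu (tuple_measure mu n')
  end.

End tuple_measure.

Section lebesgue_col.
Context (R : realType).

Definition col_of_tuple n (t : n.-tuple R) : 'cV[R]_n := \col_i tnth t i.

Definition tuple_of_col n (v : 'cV[R]_n) : n.-tuple R := [tuple v i 0 | i < n].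

Lemma measurable_mx_entry m n (i : 'I_m) (j : 'I_n) :
  measurable_fun setT (fun M : 'M[R]_(m, n) => M i j).
Proof.
move=> _ Y mY; apply: sub_sigma_algebra.
by exists (i, j) => //; exists Y.
Qed.

Lemma measurable_fun_mxP d (T : measurableType d) m n
    (f : T -> 'M[R]_(m, n)) :
  measurable_fun setT f <->
  forall i j, measurable_fun setT (fun x => f x i j).
Proof.
split=> [mf i j|mf].
  exact: (measurableT_comp (measurable_mx_entry i j) mf).
apply: (@measurability _ _ _ _ setT f (@mx_entry_sets R m n) erefl).
move=> _ [A [[i j] _ [B mB <-]] <-]; rewrite !setTI.
by rewrite -[X in measurable X]setTI; exact: mf.
Qed.

Lemma measurable_col_of_tuple n : measurable_fun setT (@col_of_tuple n).
Proof.
apply/measurable_fun_mxP => i j.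
by under eq_fun do rewrite mxE; exact: measurable_tnth.
Qed.

Lemma measurable_tuple_of_col n : measurable_fun setT (@tuple_of_col n).
Proof.
apply/measurable_fun_tnthP => i.
rewrite (_ : _ \o _ = fun v : 'cV[R]_n => v i 0).
  exact: measurable_mx_entry.
by apply/funext => v; rewrite /= tnth_mktuple.
Qed.

Lemma col_of_tupleK n : cancel (@col_of_tuple n) (@tuple_of_col n).
Proof. by move=> t; apply: eq_from_tnth => i; rewrite tnth_mktuple mxE. Qed.

Definition lebesgue_col n : set 'cV[R]_n -> \bar R :=
  pushforward (tuple_measure lebesgue_measure n) (@col_of_tuple n).

Section instances.
Context (n : nat).
Local Open Scope ereal_scope.

Let push : {measure set 'cV[R]_n -> \bar R} :=
  measure_function_pushforward__canonical__measure_function_Measure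
    (tuple_measure lebesgue_measure n) (@measurable_col_of_tuple n).

Let leb0 : lebesgue_col (n := n) set0 = 0.
Proof. exact: (measure0 push). Qed.

Let leb_ge0 A : 0 <= lebesgue_col (n := n) A.
Proof. exact: (measure_ge0 push). Qed.

Let leb_sigma_additive : semi_sigma_additive (@lebesgue_col n).
Proof. exact: (@measure_semi_sigma_additive _ _ _ push). Qed.

HB.instance Definition _ := isMeasure.Build _ _ _ (@lebesgue_col n)
  leb0 leb_ge0 leb_sigma_additive.

Let leb_sigma_finite : sigma_finite setT (@lebesgue_col n).
Proof.
apply: (sigma_finite_pushforward (@measurable_tuple_of_col n)).
  exact: col_of_tupleK.
exact: (sigma_finiteT (tuple_measure lebesgue_measure n)).
Qed.

HB.instance Definition _ := Measure_isSigmaFinite.Build _ _ _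
  (@lebesgue_col n) leb_sigma_finite.

End instances.

(* Lebesgue measure times counting measure, on pairs (state, mode). *)
Definition hybrid_measure n m : set ('cV[R]_n * 'I_m.+1) -> \bar R :=
  (@lebesgue_col n \x @counting 'I_m.+1 R)%E.

HB.instance Definition _ n m := Measure.copy (@hybrid_measure n m)
  (@lebesgue_col n \x @counting 'I_m.+1 R)%E.

HB.instance Definition _ n m := Measure_isSigmaFinite.Build _ _ _
  (@hybrid_measure n m)
  (sigma_finite_prod (@lebesgue_col n) (@counting 'I_m.+1 R)).

End lebesgue_col.

Arguments lebesgue_col : clear implicits.
Arguments hybrid_measure : clear implicits.

(** * Conditional densities *)

Section conditioning.
Context d d1 d2 (Om : measurableType d) (T1 : measurableType d1)
  (T2 : measurableType d2) (R : realType) (P : probability Om R).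
Local Open Scope ereal_scope.

(* (u, v) |-> f u v is a version of the conditional density p(v | u) of V
   given U, with respect to mu.  Versions are only determined up to null sets
   of u, and so is the content of this predicate. *)
Definition cond_density (U : Om -> T1) (V : Om -> T2)
    (mu : {measure set T2 -> \bar R}) (f : T1 -> T2 -> R) : Prop :=
  [/\ measurable_fun setT (fun uv : T1 * T2 => f uv.1 uv.2),
      forall u v, (0 <= f u v)%R &
      forall A B, measurable A -> measurable B ->
        P (U @^-1` A `&` V @^-1` B) =
        \int[P]_(w in U @^-1` A) \int[mu]_(v in B) (f (U w) v)%:E].

(* Conditionally on U, the law of W depends only on S: each conditional
   probability P(W in D | U) has a version that is a function of S.  This is
   meant for an S that is itself a function of U. *)
Definition cond_depends_only d3 (T3 : measurableType d3)
    (U : Om -> T1) (S : Om -> T3) (W : Om -> T2) : Prop :=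
  forall D, measurable D -> exists h : T3 -> \bar R,
    [/\ measurable_fun setT h, forall s, 0 <= h s &
        forall A, measurable A ->
          P (U @^-1` A `&` W @^-1` D) = \int[P]_(w in U @^-1` A) h (S w)].

End conditioning.

(* (U a, ..., U (a + n - 1)); time indices start at 1, so U 0 is unused. *)
Definition window Om T (U : nat -> Om -> T) (a n : nat) (w : Om) : n.-tuple T :=
  [tuple U (a + i)%N w | i < n].

(* The n entries of y from position a on; positions start at 0. *)
Definition subtuple (V : nmodType) N (y : N.-tuple V) (a n : nat) :
    n.-tuple V :=
  [tuple nth 0 y (a + i)%N | i < n].

(** * Matrices, Gaussian densities and quadratic likelihoods *)

Section matrices.
Context {R : realType}.

Definition quad n (M : 'M[R]_n) (v : 'cV[R]_n) : R := (v^T *m M *m v) 0 0.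

Definition is_pd n (M : 'M[R]_n) : Prop :=
  M^T = M /\ forall v, v != 0 -> 0 < quad M v.

Definition is_psd n (M : 'M[R]_n) : Prop :=
  M^T = M /\ forall v, 0 <= quad M v.

(* is_trig_mx means lower triangular *)
Definition is_upper n (M : 'M[R]_n) : bool := is_trig_mx M^T.

Definition is_sqrt_factor n (S M : 'M[R]_n) : Prop :=
  is_upper S /\ S^T *m S = M.

Definition is_qless_qr n (F M : 'M[R]_n) : Prop :=
  is_upper F /\ exists2 Q : 'M[R]_n, Q^T *m Q = 1%:M & F = Q *m M.

Definition is_transition_matrix m (T : 'M[R]_m) : Prop :=
  (forall j i, 0 <= T j i) /\ (forall i, \sum_j T j i = 1).

Definition gauss_pdf n (mu : 'cV[R]_n) (P : 'M[R]_n) (x : 'cV[R]_n) : R :=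
  (Num.sqrt ((2 * pi) ^+ n * \det P))^-1 *
  expR (- 2^-1 * quad (invmx P) (x - mu)).

Definition quad_likelihood n (r : R) (s : 'cV[R]_n) (L : 'M[R]_n)
    (x : 'cV[R]_n) : R :=
  expR (- 2^-1 * (r + 2 * (x^T *m s) 0 0 + quad L x)).

End matrices.

(** * The ingredients of the smoothing step, at fixed recorded data *)

(* Each record carries a square-root factor for every matrix the step needs
   one of; any such factor is allowed. *)
Record transition (R : realType) (n m : nat) := Transition {
  tr_A : 'I_m -> 'M[R]_n;
  tr_b : 'I_m -> 'cV[R]_n;
  tr_Q : 'I_m -> 'M[R]_n;
  tr_sqrtQ : 'I_m -> 'M[R]_n;
  tr_Q_pd : forall z, is_pd (tr_Q z);
  tr_sqrtQP : forall z, is_sqrt_factor (tr_sqrtQ z) (tr_Q z)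
}.

Record filtered_mixture (R : realType) (n m : nat) := FilteredMixture {
  fm_size : nat;
  fm_w : 'I_fm_size -> 'I_m -> R;
  fm_mu : 'I_fm_size -> 'I_m -> 'cV[R]_n;
  fm_P : 'I_fm_size -> 'I_m -> 'M[R]_n;
  fm_sqrtP : 'I_fm_size -> 'I_m -> 'M[R]_n;
  fm_w_ge0 : forall i z, 0 <= fm_w i z;
  fm_P_pd : forall i z, is_pd (fm_P i z);
  fm_sqrtPP : forall i z, is_sqrt_factor (fm_sqrtP i z) (fm_P i z)
}.

Record likelihood_mixture (R : realType) (n m : nat) := LikelihoodMixture {
  lm_size : nat;
  lm_r : 'I_lm_size -> 'I_m -> R;
  lm_s : 'I_lm_size -> 'I_m -> 'cV[R]_n;
  lm_L : 'I_lm_size -> 'I_m -> 'M[R]_n;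
  lm_sqrtL : 'I_lm_size -> 'I_m -> 'M[R]_n;
  lm_L_psd : forall l z, is_psd (lm_L l z);
  lm_sqrtLP : forall l z, is_sqrt_factor (lm_sqrtL l z) (lm_L l z)
}.

Section densities.
Context {R : realType} {n m : nat}.
Implicit Types v : 'cV[R]_n * 'I_m.

Definition filtered_pdf (F : filtered_mixture R n m) v : R :=
  \sum_(i < fm_size F) fm_w i v.2 * gauss_pdf (fm_mu i v.2) (fm_P i v.2) v.1.

Definition likelihood_pdf (B : likelihood_mixture R n m) v : R :=
  \sum_(l < lm_size B)
    quad_likelihood (lm_r l v.2) (lm_s l v.2) (lm_L l v.2) v.1.

Definition transition_pdf (T : 'M[R]_m) (D : transition R n m) v v' : R :=
  T v'.2 v.2 * gauss_pdf (tr_A D v.2 *m v.1 + tr_b D v.2) (tr_Q D v.2) v'.1.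

End densities.

(* With 0-based indices, j = a * l + i enumerates the pairs (i, l). *)
Section pair_index.
Context (a b : nat).

Fact fst_index_subproof (j : 'I_(a * b)) : (j %% a < a)%N.
Proof. by case: a j => [[]|a' j] //; rewrite ltn_mod. Qed.

Fact snd_index_subproof (j : 'I_(a * b)) : (j %/ a < b)%N.
Proof.
case: a j => [[]|a' j] //.
by rewrite ltn_divLR// [ltnRHS]mulnC.
Qed.

Definition fst_index (j : 'I_(a * b)) : 'I_a := Ordinal (fst_index_subproof j).
Definition snd_index (j : 'I_(a * b)) : 'I_b := Ordinal (snd_index_subproof j).

End pair_index.

(** * The smoothed mixture *)

Section smoothing.
Context {R : realType} {n m : nat}.
Variables (T : 'M[R]_m) (D : transition R n m).
Variables (F : filtered_mixture R n m) (B : likelihood_mixture R n m).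

Definition pred_mu (i : 'I_(fm_size F)) (z : 'I_m) : 'cV[R]_(n + n) :=
  col_mx (fm_mu i z) (tr_A D z *m fm_mu i z + tr_b D z).

Definition pred_sqrtP (i : 'I_(fm_size F)) (z : 'I_m) : 'M[R]_(n + n) :=
  block_mx (fm_sqrtP i z) (fm_sqrtP i z *m (tr_A D z)^T)
           0              (tr_sqrtQ D z).

Definition pred_P (i : 'I_(fm_size F)) (z : 'I_m) : 'M[R]_(n + n) :=
  (pred_sqrtP i z)^T *m pred_sqrtP i z.

Definition smooth_index : finType := 'I_(fm_size F * lm_size B).
Definition filt_of (j : smooth_index) : 'I_(fm_size F) := fst_index j.
Definition lik_of (j : smooth_index) : 'I_(lm_size B) := snd_index j.

(* In what follows z is the mode at time k and z' the mode at time k + 1. *)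
Definition smooth_J (j : smooth_index) (z z' : 'I_m) : 'M[R]_(n + n) :=
  block_mx
    0 (fm_sqrtP (filt_of j) z *m (tr_A D z)^T *m (lm_sqrtL (lik_of j) z')^T)
    0 (tr_sqrtQ D z *m (lm_sqrtL (lik_of j) z')^T).

Definition smooth_qr_input (j : smooth_index) (z z' : 'I_m) :
    'M[R]_((n + n) + (n + n)) :=
  block_mx 1%:M             0
           (smooth_J j z z') (pred_sqrtP (filt_of j) z).

(* The upper triangular factors are not unique: they are an input. *)
Variable F_qr : smooth_index -> 'I_m -> 'I_m -> 'M[R]_((n + n) + (n + n)).

Definition smooth_sqrtP j z z' : 'M[R]_(n + n) := drsubmx (F_qr j z z').

Definition smooth_P j z z' : 'M[R]_(n + n) :=
  (smooth_sqrtP j z z')^T *m smooth_sqrtP j z z'.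

Definition smooth_mu j z z' : 'cV[R]_(n + n) :=
  smooth_P j z z' *m (invmx (pred_P (filt_of j) z) *m pred_mu (filt_of j) z
                      - col_mx 0 (lm_s (lik_of j) z')).

(* Extended-real valued: lne 0 = -oo and expeR -oo = 0. *)
Definition smooth_beta j z z' : \bar R :=
  ((quad (invmx (smooth_P j z z')) (smooth_mu j z z'))%:E
   + 2%:E * lne (fm_w (filt_of j) z)%:E + 2%:E * lne (T z' z)%:E
   - (quad (invmx (pred_P (filt_of j) z)) (pred_mu (filt_of j) z))%:E
   - (lm_r (lik_of j) z')%:E
   + lne (\det (smooth_P j z z'))%:E - lne (\det (pred_P (filt_of j) z))%:E)%E.

Definition smooth_wtilde j z z' : R :=
  fine (expeR (2^-1%:E * smooth_beta j z z')).

Definition smooth_w j z z' : R :=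
  smooth_wtilde j z z' /
  \sum_(z1 < m) \sum_(z0 < m) \sum_(p : smooth_index) smooth_wtilde p z0 z1.

(* As a density in ((x_(k+1), z_(k+1)), (x_k, z_k)). *)
Definition smoothed_pdf
    (v : ('cV[R]_n * 'I_m) * ('cV[R]_n * 'I_m)) : R :=
  let: ((x', z'), (x, z)) := v in
  \sum_(j : smooth_index)
    smooth_w j z z' *
    gauss_pdf (smooth_mu j z z') (smooth_P j z z') (col_mx x x').

End smoothing.

(* Main.v *)
(* Chaining the given conditional densities, the law of
   (y_{1:k}, (x_k, z_k), (x_{k+1}, z_{k+1}), y_{k+1:N}) is
   P(dy_{1:k}) times q, the product filtered density * transition density *
   likelihood.  Bayes' rule turns this into the density q / int q of the two
   hybrid states given y_{1:N}.  For each pair (i, l) the product of the two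
   Gaussians is a joint Gaussian in (x_k, x_{k+1}), and completing the square
   against the quadratic likelihood gives w~^j times the Gaussian with
   information matrix P^-1 + diag(0, L); the QR factor R_22 is a square root of
   the inverse of that matrix.  Gaussians integrate to one, so
   int q = sum of the w~^j, which is the denominator of the weights. *)

Require Import Defs.
From HB Require Import structures.
From mathcomp Require Import all_boot all_order all_algebra.
From mathcomp Require Import all_classical all_reals all_analysis.
From mathcomp Require Import measurable_realfun random_variable.
From mathcomp Require Import ring.

Set Implicit Arguments.
Unset Strict Implicit.
Unset Printing Implicit Defensive.

Import Order.TTheory GRing.Theory Num.Theory.

Local Open Scope classical_set_scope.
Local Open Scope ring_scope.

(** * Conditional densities *)

(** The given densities condition on mismatched variables. The transition density is given the whole
    history but reads only [y_k], [x_k], [z_k], so it can be coarsened. The likelihood is given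
    [(x_{k+1}, z_{k+1})] alone and has to be refined to a conditioning that also contains [y_{1:k}]
    and [(x_k, z_k)]; this is the one place where the conditional independence of the future
    observations enters. Conditional densities are versions, tested by integrals over events,
    whereas the Gaussian algebra and the value of [int q] hold for every record. The only
    almost-sure argument is therefore the one in [cond_depends_density]. Degenerate data are
    covered. A zero weight or transition probability makes [smooth_beta] equal to [-oo], hence the
    smoothed weight 0. Where [int q = 0], division by zero returns 0, and the integral of [q] over
    any event vanishes too. The QR factors may be picked for each record in an arbitrary, even
    nonmeasurable way: the smoothed density equals [q / int q] whatever the choice, and inherits its
    measurability in the record from [q]. *)

Section density.
Context d (T : measurableType d) (R : realType).
Variables (mu : {measure set T -> \bar R}) (g : T -> R).
Hypotheses (mg : measurable_fun setT g) (g0 : forall x, 0 <= g x).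
Local Open Scope ereal_scope.
Import HBNNSimple.

Definition density_measure (A : set T) : \bar R := \int[mu]_(x in A) (g x)%:E.

Let density0 : density_measure set0 = 0.
Proof. exact: integral_set0. Qed.

Let density_ge0 A : 0 <= density_measure A.
Proof. by apply: integral_ge0 => x _; exact: g0. Qed.

Let density_sigma_additive : semi_sigma_additive density_measure.
Proof.
move=> /= A mA tA mUA.
rewrite /density_measure ge0_integral_bigcup//.
- by apply: is_cvg_ereal_nneg_natsum_cond => n _ _; exact: density_ge0.
- by apply/measurable_EFinP; exact: measurable_funTS.
- by move=> x _; rewrite lee_fin.
Qed.

HB.instance Definition _ := isMeasure.Build _ _ _ density_measure
  density0 density_ge0 density_sigma_additive.

(** Ladder from indicators to simple functions to monotone limits. [m] is kept apart from
    [density_measure], with agreement on measurable sets only, so that the law of a pair of random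
    variables can be plugged in. *)
Lemma integral_density (m : {measure set T -> \bar R}) (f : T -> \bar R) :
  (forall A, measurable A -> m A = density_measure A) ->
  measurable_fun setT f -> (forall x, 0 <= f x) ->
  \int[m]_x f x = \int[mu]_x (f x * (g x)%:E).
Proof.
move=> mE mf f0; pose h := nnsfun_approx measurableT mf.
have fE x : f x = lim ((EFin \o h n) x @[n --> \oo]).
  by apply/esym/cvg_lim => //; exact: cvg_nnsfun_approx.
have nd_h x a b : (a <= b)%N -> (h a x <= h b x)%R.
  by move=> ab; exact/lefP/nd_nnsfun_approx.
transitivity (lim (\int[m]_x (EFin \o h n) x @[n --> \oo])).
  under eq_integral => x _ do rewrite fE.
  apply: monotone_convergence => //.
  - by move=> n; exact/measurable_EFinP.
  - by move=> n x _ /=; rewrite lee_fin.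
  - by move=> x _ a b ab; rewrite lee_fin nd_h.
transitivity (lim (\int[mu]_x ((EFin \o h n) x * (g x)%:E) @[n --> \oo]));
  last first.
  rewrite -monotone_convergence//.
  - apply: eq_integral => x _; apply/cvg_lim => //.
    by apply: cvgeZr => //; exact: cvg_nnsfun_approx.
  - by move=> n; apply: emeasurable_funM => //; exact/measurable_EFinP.
  - by move=> n x _; rewrite mule_ge0//= lee_fin.
  - by move=> x _ a b ab; rewrite lee_pmul//= lee_fin ?nd_h.
suff hE n : \int[m]_x (h n x)%:E = \int[mu]_x ((h n x)%:E * (g x)%:E).
  by under eq_fun do rewrite /= hE.
under eq_integral do rewrite fimfunE -fsumEFin//.
rewrite ge0_integral_fsum//; last 2 first.
- by move=> r; exact/measurable_EFinP/measurable_funM.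
- by move=> r x _; rewrite nnfun_muleindic_ge0.
transitivity (\int[mu]_x (\sum_(r \in range (h n))
    (r * \1_(h n @^-1` [set r]) x)%:E * (g x)%:E)); last first.
  apply: eq_integral => x _.
  rewrite -ge0_mule_fsuml; last by move=> y; exact: nnfun_muleindic_ge0.
  by rewrite fsumEFin// -fimfunE.
rewrite ge0_integral_fsum//; last 2 first.
- move=> r; apply: emeasurable_funM; last exact/measurable_EFinP.
  by apply/measurable_EFinP/measurable_funM.
- by move=> r x _; rewrite mule_ge0 ?lee_fin//; exact: nnfun_muleindic_ge0.
apply: eq_fsbigr => r /[!inE] -[y _ yr].
have r0 : (0 <= r)%R by rewrite -yr.
rewrite integralZl_indic_nnsfun// integral_indic// setIT mE//.
rewrite /density_measure integral_mkcond.
under [in RHS]eq_integral do rewrite EFinM -muleA.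
rewrite ge0_integralZl//; last 2 first.
- by apply: emeasurable_funM; exact/measurable_EFinP.
- by move=> x _; rewrite mule_ge0//= lee_fin.
congr (_ * _); apply: eq_integral => x _.
by rewrite patchE indicE; case: ifPn => _; rewrite ?mul1e ?mul0e.
Qed.

End density.

(** Rectangles form a pi-system that generates the product sigma-algebra; finiteness of [m1] lets
    the constant sequence [setT] serve as exhaustion. *)
Lemma measure_unique_prod d1 d2 (T1 : measurableType d1)
    (T2 : measurableType d2) (R : realType)
    (m1 m2 : {measure set (T1 * T2) -> \bar R}) :
  (m1 setT < +oo)%E ->
  (forall A B, measurable A -> measurable B -> m1 (A `*` B) = m2 (A `*` B)) ->
  forall C, measurable C -> m1 C = m2 C.
Proof.
move=> fin m12 C mC.
apply: (measure_unique [set C | exists2 A, measurable A &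
   exists2 B, measurable B & A `*` B = C] (fun=> setT)) => //.
- exact: measurable_prod_measurableType.
- move=> _ _ [A1 mA1 [B1 mB1 <-]] [A2 mA2 [B2 mB2 <-]].
  exists (A1 `&` A2); first exact: measurableI.
  by exists (B1 `&` B2); [exact: measurableI|rewrite setXI].
- by move=> _; exists setT => //; exists setT => //; rewrite setXTT.
- by rewrite bigcup_const//; exists 0%N.
- by move=> _ [A mA [B mB <-]]; exact: m12.
Qed.

(* The sigma-finiteness instance on [\x] is not found by unification. *)
Definition prod_sigma_finite d1 d2 (T1 : measurableType d1)
    (T2 : measurableType d2) (R : realType)
    (mu : {sigma_finite_measure set T1 -> \bar R})
    (nu : {sigma_finite_measure set T2 -> \bar R}) :
    {sigma_finite_measure set (T1 * T2)%type -> \bar R} :=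
  HB.pack_for {sigma_finite_measure set (T1 * T2)%type -> \bar R}
    (mu \x nu)%E
    (Measure_isSigmaFinite.Build _ _ _ (mu \x nu)%E (sigma_finite_prod mu nu)).

Section prod_tonelli.
Context d1 d2 (T1 : measurableType d1) (T2 : measurableType d2) (R : realType).
Variables (mu : {sigma_finite_measure set T1 -> \bar R})
  (nu : {sigma_finite_measure set T2 -> \bar R}).
Local Open Scope ereal_scope.

Lemma prod_tonelli1 (f : T1 * T2 -> \bar R) :
  measurable_fun setT f -> (forall x, 0 <= f x) ->
  \int[prod_sigma_finite mu nu]_x f x = \int[mu]_x \int[nu]_y f (x, y).
Proof. exact: fubini_tonelli1. Qed.

Lemma prod_tonelli2 (f : T1 * T2 -> \bar R) :
  measurable_fun setT f -> (forall x, 0 <= f x) ->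
  \int[prod_sigma_finite mu nu]_x f x = \int[nu]_y \int[mu]_x f (x, y).
Proof. exact: fubini_tonelli2. Qed.

End prod_tonelli.

Lemma integral_indicM d (T : measurableType d) (R : realType)
    (mu : {measure set T -> \bar R}) (D : set T) (f : T -> \bar R) :
  (\int[mu]_(x in D) f x = \int[mu]_x ((\1_D x)%:E * f x))%E.
Proof.
rewrite integral_mkcond; apply: eq_integral => x _.
by rewrite patchE indicE; case: ifPn => _; rewrite ?mul1e ?mul0e.
Qed.

Section cond_density_theory.
Context d (Om : measurableType d) (R : realType) (P : probability Om R).
Local Open Scope ereal_scope.

(** [cond_density] tests rectangles only. It says that the law of [(U, V)] agrees on them with the
    measure of density [f] against the product of the law of [U] with [mu]; by [measure_unique_prod]
    they agree everywhere, and [integral_density] handles arbitrary nonnegative [phi]. *)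
Lemma cond_density_integral d1 d2 (T1 : measurableType d1)
    (T2 : measurableType d2) (U : Om -> T1) (V : Om -> T2)
    (mu : {sigma_finite_measure set T2 -> \bar R}) f
    (mU : measurable_fun setT U) (mV : measurable_fun setT V) :
  cond_density P U V mu f ->
  forall phi : T1 * T2 -> \bar R,
  measurable_fun setT phi -> (forall x, 0 <= phi x) ->
  \int[P]_w phi (U w, V w) =
  \int[P]_w \int[mu]_v (phi (U w, v) * (f (U w) v)%:E).
Proof.
move=> [mf f0 fE] phi mphi phi0.
have mUV : measurable_fun setT (fun w => (U w, V w)).
  exact: measurable_fun_pair.
pose PU : probability T1 R :=
  distribution P (HB.pack U (isMeasurableFun.Build _ _ _ _ _ mU)).
pose PUV : probability (T1 * T2)%type R :=
  distribution P (HB.pack (fun w => (U w, V w))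
    (isMeasurableFun.Build _ _ _ _ _ mUV)).
pose g (x : T1 * T2) := f x.1 x.2.
have mg : measurable_fun setT g by [].
have g0 x : (0 <= g x)%R by exact: f0.
have mgE : measurable_fun setT (EFin \o g) by exact/measurable_EFinP.
have mphig : measurable_fun setT (fun x => phi x * (g x)%:E).
  exact: emeasurable_funM.
transitivity (\int[PUV]_x phi x).
  by rewrite /PUV ge0_integral_pushforward.
rewrite (integral_density (mu := (PU \x mu)%E) mg g0)//; last first.
  apply: (measure_unique_prod (m2 := density_measure (PU \x mu)%E g)).
    by rewrite (le_lt_trans (probability_le1 _ _)) ?ltry.
  move=> A B mA mB; rewrite [LHS]fE//= /density_measure integral_mkcond.
  rewrite fubini_tonelli1//=; last 2 first.
  - apply/(measurable_restrictT _ _).1 => //; first exact: measurableX.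
    exact: measurable_funTS.
  - by move=> x; rewrite patchE; case: ifP; rewrite //= lee_fin.
  rewrite /fubini_F /PU ge0_integral_pushforward//=; last 2 first.
  - apply: (measurable_fun_fubini_tonelli_F (m2 := mu)
      ((EFin \o g) \_ (A `*` B))).
    + apply/(measurable_restrictT _ _).1 => //; first exact: measurableX.
      exact: measurable_funTS.
    + by move=> x; rewrite patchE; case: ifP; rewrite //= lee_fin.
  - move=> x _; apply: integral_ge0 => y _.
    by rewrite patchE; case: ifP; rewrite //= lee_fin.
  rewrite integral_mkcond; apply: eq_integral => w _ /=.
  rewrite patchE; case: ifPn => [|] Aw.
    rewrite [in LHS]integral_mkcond; apply: eq_integral => v _.
    rewrite !patchE /g/=.
    have -> // : ((U w, v) \in A `*` B) = (v \in B).
    by rewrite in_setX/=; move: Aw; rewrite !inE => Aw; rewrite mem_set.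
  rewrite integral0_eq// => v _; rewrite patchE.
  rewrite in_setX/= ifF//; apply/negbTE; move: Aw; apply: contra => /andP[].
  by rewrite !inE.
rewrite fubini_tonelli1//=; last by move=> x; rewrite mule_ge0//= lee_fin.
rewrite /fubini_F /PU ge0_integral_pushforward//=.
- apply: (measurable_fun_fubini_tonelli_F (m2 := mu)
    (fun x => phi x * (g x)%:E)) => // x.
  by rewrite mule_ge0//= lee_fin.
- by move=> x _; apply: integral_ge0 => y _; rewrite mule_ge0//= lee_fin.
Qed.

(** Every event about [g \o U] is an event about [U], so coarsening the conditioning is free once
    the density sees [U] only through [g]. *)
Lemma cond_density_comp d1 d2 d3 (T1 : measurableType d1)
    (T2 : measurableType d2) (T3 : measurableType d3) (g : T1 -> T3)
    (U : Om -> T1) (V : Om -> T2) (mu : {measure set T2 -> \bar R})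
    (f : T3 -> T2 -> R) :
  measurable_fun setT g ->
  measurable_fun setT (fun x : T3 * T2 => f x.1 x.2) ->
  (forall u v, (0 <= f u v)%R) ->
  cond_density P U V mu (fun u => f (g u)) -> cond_density P (g \o U) V mu f.
Proof.
move=> mg mf f0 [_ _ fE]; split => // A B mA mB.
rewrite [LHS](fE (g @^-1` A))//.
by rewrite -[_ @^-1` _]setTI; exact: mg.
Qed.

(** Here measurability and sign of [f] itself are recovered from those of [f (g u)], by composing
    with the measurable right inverse [c] of [g]. *)
Lemma cond_density_comp_section d1 d2 d3 (T1 : measurableType d1)
    (T2 : measurableType d2) (T3 : measurableType d3)
    (g : T1 -> T3) (c : T3 -> T1) (U : Om -> T1) (V : Om -> T2)
    (mu : {measure set T2 -> \bar R}) (f : T3 -> T2 -> R) :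
  measurable_fun setT g -> measurable_fun setT c -> cancel c g ->
  cond_density P U V mu (fun u => f (g u)) -> cond_density P (g \o U) V mu f.
Proof.
move=> mg mc cK fP; have [mf f0 _] := fP; apply: cond_density_comp => //.
  rewrite (_ : (fun x => _) = (fun x : T1 * T2 => f (g x.1) x.2) \o
      (fun x : T3 * T2 => (c x.1, x.2))); last first.
    by apply/funext => x /=; rewrite cK.
  apply: (measurableT_comp mf); apply: measurable_fun_pair => //.
  exact: (measurableT_comp mc).
by move=> u v; rewrite -(cK u).
Qed.

(** The product rule [p(w, v | u) = p(v | u) p(w | u, v)]. The new variable goes first in the pair,
    so that two uses produce the nesting [(W, (S, V))] expected by [cond_density_bayes]. *)
Lemma cond_density_chain d1 d2 d3 (T1 : measurableType d1)
    (T2 : measurableType d2) (T3 : measurableType d3)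
    (U : Om -> T1) (V : Om -> T2) (W : Om -> T3)
    (mu : {sigma_finite_measure set T2 -> \bar R})
    (nu : {sigma_finite_measure set T3 -> \bar R}) f g :
  measurable_fun setT U -> measurable_fun setT V -> measurable_fun setT W ->
  cond_density P U V mu f ->
  cond_density P (fun w => (U w, V w)) W nu g ->
  cond_density P U (fun w => (W w, V w)) (prod_sigma_finite nu mu)
    (fun u x => (f u x.2 * g (u, x.2) x.1)%R).
Proof.
move=> mU mV mW fd gd; have [mf f0 _] := fd; have [mg g0 _] := gd.
have mfg : measurable_fun setT
    (fun x : T1 * (T3 * T2) => (f x.1 x.2.2 * g (x.1, x.2.2) x.2.1)%R).
  apply: measurable_funM.
    apply: (measurableT_comp mf (g := fun x : T1 * (T3 * T2) => (x.1, x.2.2))).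
    apply: measurable_fun_pair => //.
    exact: (measurableT_comp measurable_snd measurable_snd).
  apply: (measurableT_comp mg
    (g := fun x : T1 * (T3 * T2) => ((x.1, x.2.2), x.2.1))).
  apply: measurable_fun_pair => //; first apply: measurable_fun_pair => //.
    exact: (measurableT_comp measurable_snd measurable_snd).
  exact: (measurableT_comp measurable_fst measurable_snd).
split => // [u x|A B mA mB]; first by rewrite mulr_ge0.
have mUV : measurable_fun setT (fun w => (U w, V w)).
  exact: measurable_fun_pair.
pose phi (x : (T1 * T2) * T3) : \bar R :=
  (\1_A x.1.1)%:E * (\1_B (x.2, x.1.2))%:E.
have mphi : measurable_fun setT phi.
  apply: emeasurable_funM; apply/measurable_EFinP.
    apply: (measurableT_comp (measurable_indic mA)).
    exact: (measurableT_comp measurable_fst measurable_fst).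
  apply: (measurableT_comp (measurable_indic mB)).
  apply: measurable_fun_pair => //.
  exact: (measurableT_comp measurable_snd measurable_fst).
have phi0 x : 0 <= phi x by rewrite mule_ge0// lee_fin.
(* Result of integrating [W] out at fixed [(U, V)]; as a function of [(U, V)] it can then be
   integrated with the density of [V] given [U]. *)
pose psi (x : T1 * T2) := \int[nu]_w (phi (x, w) * (g x w)%:E).
have mphig : measurable_fun setT
    (fun y : (T1 * T2) * T3 => phi y * (g y.1 y.2)%:E).
  by apply: emeasurable_funM => //; exact/measurable_EFinP.
have phig0 y : 0 <= phi y * (g y.1 y.2)%:E by rewrite mule_ge0// lee_fin.
have mpsi : measurable_fun setT psi.
  exact: (measurable_fun_fubini_tonelli_F (m2 := nu)
    (fun y : (T1 * T2) * T3 => phi y * (g y.1 y.2)%:E)).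
have psi0 x : 0 <= psi x.
  by apply: integral_ge0 => w _; exact: (phig0 (x, w)).
have -> : P (U @^-1` A `&` (fun w => (W w, V w)) @^-1` B) =
    \int[P]_w phi ((U w, V w), W w).
  rewrite -[in LHS](setIT (_ `&` _)) -integral_indic//; last first.
    apply: measurableI; rewrite -[_ @^-1` _]setTI; first exact: mU.
    exact: (measurable_fun_pair mW mV).
  apply: eq_integral => w _.
  by rewrite /phi -EFinM indicI.
rewrite (cond_density_integral mUV mW gd mphi phi0).
under eq_integral => w _ do rewrite -/(psi (U w, V w)).
rewrite (cond_density_integral mU mV fd mpsi psi0).
rewrite [RHS]integral_indicM; apply: eq_integral => o _.
rewrite (integral_indicM _ B) prod_tonelli2//; last 2 first.
- apply: emeasurable_funM; apply/measurable_EFinP.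
    exact: measurable_indic.
  exact: (measurableT_comp mfg (pair1_measurable (U o))).
- by move=> x; rewrite -EFinM lee_fin !mulr_ge0.
rewrite -ge0_integralZl//; last 2 first.
- apply: (measurable_fun_fubini_tonelli_G (m1 := nu) (fun x => (\1_B x)%:E *
    (f (U o) x.2 * g (U o, x.2) x.1)%:E)).
    apply: emeasurable_funM; apply/measurable_EFinP.
      exact: measurable_indic.
    exact: (measurableT_comp mfg (pair1_measurable (U o))).
  by move=> x; rewrite -EFinM lee_fin !mulr_ge0.
- move=> v _; apply: integral_ge0 => w _.
  by rewrite -EFinM lee_fin !mulr_ge0.
apply: eq_integral => v _.
rewrite /psi muleC -ge0_integralZl//; last 2 first.
- exact: (measurableT_comp mphig (pair1_measurable (U o, v))).
- by rewrite lee_fin.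
rewrite -ge0_integralZl//; last 2 first.
- apply: emeasurable_funM; apply/measurable_EFinP.
    exact: (measurableT_comp (measurable_indic mB) (pair2_measurable v)).
  apply: measurable_funM => /=; first exact: measurable_cst.
  exact: (measurableT_comp mg (pair1_measurable (U o, v))).
- by move=> w _; rewrite -EFinM lee_fin !mulr_ge0.
apply: eq_integral => w _; rewrite /phi/= -!EFinM; congr EFin.
by rewrite mulrCA !mulrA.
Qed.

(** Hypothesis [gE] makes the normalizer finite everywhere but allows it to vanish, in which case
    the quotient is 0. *)
Lemma cond_density_bayes d1 d2 d3 (T1 : measurableType d1)
    (T2 : measurableType d2) (T3 : measurableType d3)
    (U : Om -> T1) (V : Om -> T2) (W : Om -> T3)
    (mu : {sigma_finite_measure set T2 -> \bar R})
    (nu : {sigma_finite_measure set T3 -> \bar R}) q (g : T1 -> T3 -> R) :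
  measurable_fun setT U -> measurable_fun setT V -> measurable_fun setT W ->
  cond_density P U (fun w => (W w, V w)) (prod_sigma_finite nu mu) q ->
  (forall u w, \int[mu]_v (q u (w, v))%:E = (g u w)%:E) ->
  cond_density P (fun w => (U w, W w)) V mu
    (fun uw v => q uw.1 (uw.2, v) / g uw.1 uw.2)%R.
Proof.
move=> mU mV mW qd gE; have [mq q0 _] := qd.
have mWV : measurable_fun setT (fun w => (W w, V w)).
  exact: measurable_fun_pair.
have g0 u w : (0 <= g u w)%R.
  by rewrite -lee_fin -gE; apply: integral_ge0 => v _; rewrite lee_fin.
have mq' : measurable_fun setT
    (fun x : (T1 * T3) * T2 => q x.1.1 (x.1.2, x.2)).
  apply: (measurableT_comp mq
    (g := fun x : (T1 * T3) * T2 => (x.1.1, (x.1.2, x.2)))).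
  apply: measurable_fun_pair.
    exact: (measurableT_comp measurable_fst measurable_fst).
  apply: measurable_fun_pair => //.
  exact: (measurableT_comp measurable_snd measurable_fst).
have mg : measurable_fun setT (fun x : T1 * T3 => g x.1 x.2).
  apply/measurable_EFinP.
  rewrite (_ : _ \o _ = fun x : T1 * T3 => \int[mu]_v (q x.1 (x.2, v))%:E).
    apply: (measurable_fun_fubini_tonelli_F (m2 := mu)
      (fun x : (T1 * T3) * T2 => (q x.1.1 (x.1.2, x.2))%:E)).
      exact/measurable_EFinP.
    by move=> x; rewrite lee_fin.
  by apply/funext => x /=; rewrite gE.
have mqg : measurable_fun setT
    (fun x : (T1 * T3) * T2 => (q x.1.1 (x.1.2, x.2) / g x.1.1 x.1.2)%R).
  apply: measurable_funM => //.
  (* Inversion is written as the power [-1] to get measurability; on nonnegative reals the two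
     agree, also at 0, where both are 0. *)
  rewrite [X in measurable_fun _ X](_ : _ = @powR R ^~ (-1)%R \o
      (fun x : (T1 * T3) * T2 => g x.1.1 x.1.2)); last first.
    by apply/funext => x /=; rewrite powR_inv1.
  apply: measurableT_comp; first exact: measurable_powR.
  exact: (measurableT_comp mg measurable_fst).
have qg0 x v : (0 <= q x.1 (x.2, v) / g x.1 x.2)%R.
  by rewrite mulr_ge0 ?invr_ge0.
split => // A B mA mB.
pose h (x : T1 * T3) :=
  \int[mu]_(v in B) (q x.1 (x.2, v) / g x.1 x.2)%:E.
have h0 x : 0 <= h x by apply: integral_ge0 => v _; rewrite lee_fin.
have mh : measurable_fun setT h.
  rewrite /h; under eq_fun do rewrite integral_indicM.
  apply: (measurable_fun_fubini_tonelli_F (m2 := mu)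
    (fun x : (T1 * T3) * T2 => (\1_B x.2)%:E *
      (q x.1.1 (x.1.2, x.2) / g x.1.1 x.1.2)%:E)).
    apply: emeasurable_funM; apply/measurable_EFinP => //.
    exact: (measurableT_comp (measurable_indic mB) measurable_snd).
  by move=> x; rewrite -EFinM lee_fin mulr_ge0.
have hg u w : h (u, w) * (g u w)%:E = \int[mu]_(v in B) (q u (w, v))%:E.
  have mquw : measurable_fun setT (fun v => q u (w, v)).
    exact: (measurableT_comp mq' (pair1_measurable (u, w))).
  (* If the normalizer is 0, the left side is 0, and the integral over [B] lies between 0 and the
     full integral [g u w = 0]. *)
  have [guw|guw] := eqVneq (g u w) 0%R.
    rewrite guw mule0; apply/esym/eqP; rewrite eq_le; apply/andP; split.
      rewrite -[leRHS]/0%R%:E -guw -gE; apply: ge0_subset_integral => //.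
        exact/measurable_EFinP.
      by move=> v _; rewrite lee_fin.
    by apply: integral_ge0 => v _; rewrite lee_fin.
  rewrite /h muleC -ge0_integralZl//; last 3 first.
  - apply/measurable_EFinP/measurable_funTS.
    exact: (measurableT_comp mqg (pair1_measurable (u, w))).
  - by move=> v _; rewrite lee_fin (qg0 (u, w)).
  - by rewrite lee_fin.
  by apply: eq_integral => v _; rewrite -EFinM/= mulrCA divff// mulr1.
pose phi (x : T1 * (T3 * T2)) : \bar R :=
  (\1_A (x.1, x.2.1))%:E * (\1_B x.2.2)%:E.
have m12 : measurable_fun setT (fun x : T1 * (T3 * T2) => (x.1, x.2.1)).
  apply: measurable_fun_pair => //.
  exact: (measurableT_comp measurable_fst measurable_snd).
have mphi : measurable_fun setT phi.
  apply: emeasurable_funM; apply/measurable_EFinP.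
    exact: (measurableT_comp (measurable_indic mA) m12).
  apply: (measurableT_comp (measurable_indic mB)).
  exact: (measurableT_comp measurable_snd measurable_snd).
have phi0 x : 0 <= phi x by rewrite mule_ge0// lee_fin.
pose phi2 (x : T1 * (T3 * T2)) : \bar R :=
  (\1_A (x.1, x.2.1))%:E * h (x.1, x.2.1).
have mphi2 : measurable_fun setT phi2.
  apply: emeasurable_funM; last exact: (measurableT_comp mh m12).
  apply/measurable_EFinP.
  exact: (measurableT_comp (measurable_indic mA) m12).
have phi20 x : 0 <= phi2 x by rewrite mule_ge0// lee_fin.
have -> : P ((fun w => (U w, W w)) @^-1` A `&` V @^-1` B) =
    \int[P]_w phi (U w, (W w, V w)).
  rewrite -[in LHS](setIT (_ `&` _)) -integral_indic//; last first.
    apply: measurableI; rewrite -[_ @^-1` _]setTI; last exact: mV.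
    exact: (measurable_fun_pair mU mW).
  by apply: eq_integral => w _; rewrite /phi -EFinM indicI.
rewrite (cond_density_integral mU mWV qd mphi phi0).
rewrite [RHS]integral_indicM.
(* The right side is also read as the integral of a function of [(U, (W, V))], one that ignores [V].
   The joint density [q] then applies to both sides, and integrating [v] out on the right yields the
   factor [g] that cancels the denominator. *)
transitivity (\int[P]_w phi2 (U w, (W w, V w))); last by [].
apply: (etrans _ (esym (cond_density_integral mU mWV qd mphi2 phi20))).
apply: eq_integral => o _.
have mqo : measurable_fun setT (fun x => (q (U o) x)%:E).
  apply/measurable_EFinP.
  exact: (measurableT_comp mq (pair1_measurable (U o))).
rewrite !prod_tonelli1//; last 4 first.
- apply: emeasurable_funM => //.
  exact: (measurableT_comp mphi2 (pair1_measurable (U o))).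
- by move=> x; rewrite mule_ge0// lee_fin.
- apply: emeasurable_funM => //.
  exact: (measurableT_comp mphi (pair1_measurable (U o))).
- by move=> x; rewrite mule_ge0// lee_fin.
apply: eq_integral => w _; rewrite /phi /phi2/=.
have mqow : measurable_fun setT (fun v => (q (U o) (w, v))%:E).
  exact: (measurableT_comp mqo (pair1_measurable w)).
rewrite ge0_integralZl//; last 2 first.
- by move=> v _; rewrite lee_fin.
- by rewrite mule_ge0// lee_fin.
rewrite gE -muleA hg -ge0_integralZl//; last 2 first.
- exact: measurable_funTS.
- by move=> v _; rewrite lee_fin.
rewrite [RHS]integral_indicM; apply: eq_integral => v _.
by rewrite muleA (muleC (\1_B v)%:E).
Qed.

(* The version [h] of [P(W in D | U)] and the integral over [D] of [f] have the
   same integral on every event [s U in E], hence agree almost surely. *)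
Lemma cond_depends_density d1 d2 d3 (T1 : measurableType d1)
    (T2 : measurableType d2) (T3 : measurableType d3)
    (U : Om -> T1) (W : Om -> T2) (s : T1 -> T3)
    (mu : {sigma_finite_measure set T2 -> \bar R}) f :
  measurable_fun setT U -> measurable_fun setT W -> measurable_fun setT s ->
  cond_depends_only P U (s \o U) W ->
  cond_density P (s \o U) W mu f ->
  cond_density P U W mu (fun u => f (s u)).
Proof.
move=> mU mW ms dep [mf f0 fE].
have msU : measurable_fun setT (s \o U) by exact: measurableT_comp.
split => [|//|A D mA mD].
  apply: (measurableT_comp mf (g := fun x : T1 * T2 => (s x.1, x.2))).
  by apply: measurable_fun_pair => //; exact: (measurableT_comp ms).
have [h [mh h0 hE]] := dep D mD.
pose F x := \int[mu]_(w in D) (f x w)%:E.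
have mF : measurable_fun setT F.
  rewrite /F; under eq_fun do rewrite integral_indicM.
  apply: (measurable_fun_fubini_tonelli_F (m2 := mu)
    (fun x : T3 * T2 => (\1_D x.2)%:E * (f x.1 x.2)%:E)).
    apply: emeasurable_funM; apply/measurable_EFinP => //.
    exact: (measurableT_comp (measurable_indic mD) measurable_snd).
  by move=> x; rewrite -EFinM lee_fin mulr_ge0.
have F0 x : 0 <= F x by apply: integral_ge0 => w _; rewrite lee_fin.
pose PS : probability T3 R := distribution P
  (HB.pack (s \o U) (isMeasurableFun.Build _ _ _ _ _ msU)).
have PSE (k : T3 -> \bar R) A' :
    measurable_fun setT k -> (forall x, 0 <= k x) -> measurable A' ->
    \int[PS]_(x in A') k x = \int[P]_(w in (s \o U) @^-1` A') k (s (U w)).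
  move=> mk k0 mA'; rewrite /PS ge0_integral_pushforward//.
  exact: measurable_funTS.
have hF : ae_eq PS setT h F.
  apply: integral_ae_eq => //.
  (* The total integral of [h] is the probability of [W] in [D], hence at most 1. *)
  - apply/integrableP; split => //.
    rewrite (eq_integral h); last by move=> x _; rewrite gee0_abs.
    rewrite (PSE h setT mh h0 measurableT) preimage_setT.
    rewrite -(preimage_setT U) -(hE setT measurableT).
    apply: (le_lt_trans (probability_le1 P _)); last by rewrite ltry.
    by apply: measurableI; rewrite -[_ @^-1` _]setTI; [exact: mU|exact: mW].
  - move=> E _ mE; rewrite !PSE// -fE// -(hE (s @^-1` E))//.
    by rewrite -[_ @^-1` _]setTI; exact: ms.
rewrite hE//; apply: ae_eq_integral => //.
- by rewrite -[_ @^-1` _]setTI; exact: mU.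
- by apply: measurable_funTS; exact: (measurableT_comp mh msU).
- by apply: measurable_funTS; exact: (measurableT_comp mF msU).
have [N [mN N0 NP]] := hF.
exists ((s \o U) @^-1` N); split => //.
  by rewrite -[_ @^-1` _]setTI; exact (msU measurableT N mN).
by move=> w /= hFw; apply: NP => /= hFs; apply: hFw => _; exact: hFs.
Qed.

End cond_density_theory.

(** * Gaussian integrals *)

Section measurable_matrix_functions.
Context d (T : measurableType d) (R : realType).

Lemma measurable_addmx m n (f g : T -> 'M[R]_(m, n)) :
  measurable_fun setT f -> measurable_fun setT g ->
  measurable_fun setT (fun x => f x + g x).
Proof.
move=> /measurable_fun_mxP mf /measurable_fun_mxP mg.
apply/measurable_fun_mxP => i j.
by under eq_fun do rewrite mxE; exact: measurable_funD.
Qed.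

Lemma measurable_oppmx m n (f : T -> 'M[R]_(m, n)) :
  measurable_fun setT f -> measurable_fun setT (fun x => - f x).
Proof.
move=> /measurable_fun_mxP mf; apply/measurable_fun_mxP => i j.
by under eq_fun do rewrite mxE; exact: measurable_funN.
Qed.

Lemma measurable_subr_mx m n (f g : T -> 'M[R]_(m, n)) :
  measurable_fun setT f -> measurable_fun setT g ->
  measurable_fun setT (fun x => f x - g x).
Proof.
by move=> mf mg; apply: measurable_addmx => //; exact: measurable_oppmx.
Qed.

Lemma measurable_mulmx m n p (f : T -> 'M[R]_(m, n)) (g : T -> 'M[R]_(n, p)) :
  measurable_fun setT f -> measurable_fun setT g ->
  measurable_fun setT (fun x => f x *m g x).
Proof.
move=> /measurable_fun_mxP mf /measurable_fun_mxP mg.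
apply/measurable_fun_mxP => i j; under eq_fun do rewrite mxE.
by apply: measurable_sum => k; exact: measurable_funM.
Qed.

Lemma measurable_trmx m n (f : T -> 'M[R]_(m, n)) :
  measurable_fun setT f -> measurable_fun setT (fun x => (f x)^T).
Proof.
move=> /measurable_fun_mxP mf; apply/measurable_fun_mxP => i j.
by under eq_fun do rewrite mxE; exact: mf.
Qed.

Lemma measurable_col_mx m1 m2 n
    (f : T -> 'M[R]_(m1, n)) (g : T -> 'M[R]_(m2, n)) :
  measurable_fun setT f -> measurable_fun setT g ->
  measurable_fun setT (fun x => col_mx (f x) (g x)).
Proof.
move=> /measurable_fun_mxP mf /measurable_fun_mxP mg.
apply/measurable_fun_mxP => i j; under eq_fun do rewrite mxE.
by case: (fintype.split i) => k; [exact: mf|exact: mg].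
Qed.

Lemma measurable_quad n (M : 'M[R]_n) (f : T -> 'cV[R]_n) :
  measurable_fun setT f -> measurable_fun setT (fun x => quad M (f x)).
Proof.
move=> mf; rewrite /quad.
have /measurable_fun_mxP : measurable_fun setT (fun x => (f x)^T *m M *m f x).
  apply: measurable_mulmx => //.
  apply: measurable_mulmx; last exact: measurable_cst.
  exact: measurable_trmx.
by move/(_ 0 0).
Qed.

Lemma measurable_gauss_pdf n (mu : 'cV[R]_n) P (f : T -> 'cV[R]_n) :
  measurable_fun setT f -> measurable_fun setT (fun x => gauss_pdf mu P (f x)).
Proof.
move=> mf; apply: measurable_funM; first exact: measurable_cst.
apply: (measurableT_comp (@measurable_expR R)).
apply: measurable_funM; first exact: measurable_cst.
apply: measurable_quad.
by apply: measurable_subr_mx => //; exact: measurable_cst.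
Qed.

End measurable_matrix_functions.

Lemma gauss_pdf_ge0 (R : realType) n (mu : 'cV[R]_n) P x :
  0 <= gauss_pdf mu P x.
Proof. by rewrite mulr_ge0 ?expR_ge0// invr_ge0 sqrtr_ge0. Qed.

Definition sqnorm (R : realType) n (v : 'cV[R]_n) : R := quad 1%:M v.

Section sqnorm.
Context {R : realType}.
Implicit Types m n : nat.

Lemma sqnormE n (v : 'cV[R]_n) : sqnorm v = (v^T *m v) 0 0.
Proof. by rewrite /sqnorm /quad mulmx1. Qed.

Lemma sqnorm_sum n (v : 'cV[R]_n) : sqnorm v = \sum_i (v i 0) ^+ 2.
Proof.
by rewrite sqnormE mxE; apply: eq_bigr => i _; rewrite mxE expr2.
Qed.

Lemma sqnorm_col_mx m n (x : 'cV[R]_m) (y : 'cV[R]_n) :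
  sqnorm (col_mx x y) = sqnorm x + sqnorm y.
Proof. by rewrite !sqnormE tr_col_mx mul_row_col mxE. Qed.

Lemma sqnorm_ge0 n (v : 'cV[R]_n) : 0 <= sqnorm v.
Proof. by rewrite sqnorm_sum sumr_ge0// => i _; rewrite sqr_ge0. Qed.

Lemma sqnorm_eq0 n (v : 'cV[R]_n) : (sqnorm v == 0) = (v == 0).
Proof.
apply/eqP/eqP => [|->]; last by rewrite sqnormE mulmx0 mxE.
rewrite sqnorm_sum => /eqP; rewrite psumr_eq0 => [|i _]; last exact: sqr_ge0.
move=> /allP v0; apply/colP => i; rewrite mxE.
apply/eqP; rewrite -sqrf_eq0 -[_ == 0]implyTb.
by apply: v0; rewrite mem_index_enum.
Qed.

(** For block lower triangular [W], the upper part of [W u - c] involves [x] only, and in the lower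
    part [x] merely shifts the center of [y]. An integral over [y] that does not depend on the
    center thus decouples the blocks. *)
Lemma sqnorm_lblock m n (W : 'M[R]_(m + n)) (c : 'cV[R]_(m + n)) x y :
  ursubmx W = 0 ->
  sqnorm (W *m col_mx x y - c) =
  sqnorm (ulsubmx W *m x - usubmx c) +
  sqnorm (drsubmx W *m y - (dsubmx c - dlsubmx W *m x)).
Proof.
move=> W0; rewrite -[in LHS](submxK W) W0 -{1}(vsubmxK c) mul_block_col mul0mx.
rewrite addr0 opp_col_mx add_col_mx sqnorm_col_mx opprB.
by congr (_ + sqnorm _); rewrite -addrA addrCA.
Qed.

End sqnorm.

(** Induction on the size, splitting off the first row and column: the invertible corner of [M]
    forces the upper right block of [W] to vanish, and the lower right blocks are again inverse to
    each other. *)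
Lemma is_trig_mulmx1 (R : realType) n (M W : 'M[R]_n) :
  is_trig_mx M -> M *m W = 1%:M -> is_trig_mx W.
Proof.
elim: n M W => [|n IHn] M W Mtrig MW; first by apply/is_trig_mxP => -[].
pose M' : 'M[R]_(1 + n) := M; pose W' : 'M[R]_(1 + n) := W.
have M'trig : is_trig_mx M' by [].
have : M' *m W' = 1%:M by [].
rewrite -(submxK M') -(submxK W') (ursubmx_trig (leqnn 1) M'trig).
rewrite mulmx_block !mul0mx !addr0 scalar_mx_block => /eq_block_mx[ul ur dl dr].
have W0 : ursubmx W' = 0.
  have uM : ulsubmx M' \in unitmx by case/mulmx1_unit: ul.
  by rewrite -(mulKmx uM (ursubmx W')) ur mulmx0.
move: dr; rewrite W0 mulmx0 add0r => dr.
rewrite -[is_trig_mx W]/(is_trig_mx W') -(submxK W') is_trig_block_mx// W0 eqxx.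
rewrite (IHn _ _ (drsubmx_trig (leqnn 1) M'trig) dr) andbT/=.
by apply/is_trig_mxP => i j; rewrite !ord1.
Qed.

(** Whitening: a deviation written as [S^T w] has Mahalanobis norm equal to the Euclidean norm of
    [w]. *)
Lemma quad_invmx_mulmx (R : realType) n (S : 'M[R]_n) (w : 'cV[R]_n) :
  S \in unitmx -> quad (invmx (S^T *m S)) (S^T *m w) = sqnorm w.
Proof.
move=> uS; have uST : S^T \in unitmx by rewrite unitmx_tr.
have -> : invmx (S^T *m S) = invmx S *m invmx S^T.
  have uP : S^T *m S \in unitmx by rewrite unitmx_mul uST.
  have E : S^T *m S *m (invmx S *m invmx S^T) = 1%:M.
    by rewrite -mulmxA (mulKVmx uS) mulmxV.
  by rewrite -[LHS]mulmx1 -E mulKmx.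
rewrite sqnormE /quad trmx_mul trmxK -!mulmxA; congr (fun_of_matrix _ 0 0).
by rewrite (mulKmx uST) (mulKVmx uS).
Qed.

Section gaussian_integral.
Context {R : realType}.
Implicit Types n : nat.
Local Open Scope ereal_scope.
Local Notation leb := (@lebesgue_measure R).

Lemma measurable_expR_sqnorm d (T : measurableType d) n (f : T -> 'cV[R]_n) :
  measurable_fun setT f ->
  measurable_fun setT (fun x => (expR (- 2^-1 * sqnorm (f x)))%:E).
Proof.
move=> mf; apply/measurable_EFinP.
apply: (measurableT_comp (@measurable_expR R)).
apply: measurable_funM; first exact: measurable_cst.
exact: measurable_quad.
Qed.

Lemma lebesgue_col_recl n (f : 'cV[R]_n.+1 -> \bar R) :
  measurable_fun setT f -> (forall x, 0 <= f x) ->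
  \int[lebesgue_col R n.+1]_v f v =
  \int[leb]_t \int[lebesgue_col R n]_u f (col_mx t%:M u : 'cV_(1 + n)).
Proof.
move=> mf f0.
rewrite /lebesgue_col ge0_integral_pushforward//; last first.
  exact: measurable_col_of_tuple.
have mfc : measurable_fun setT (f \o @col_of_tuple R n.+1).
  by apply: measurableT_comp => //; exact: measurable_col_of_tuple.
rewrite /= /cons_measure preimage_setT ge0_integral_pushforward//; last first.
  exact: measurable_cons_pair.
rewrite preimage_setT fubini_tonelli1; last 2 first.
- exact: (measurableT_comp mfc (@measurable_cons_pair _ _ _)).
- by move=> x; exact: f0.
apply: eq_integral => t _; rewrite /fubini_F ge0_integral_pushforward//.
- rewrite preimage_setT; apply: eq_integral => s _ /=; congr f.
  apply/colP => i; rewrite !mxE (tnth_nth 0%R)/=.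
  case: splitP => k ->; first by rewrite ord1 mxE mulr1n.
  by rewrite mxE (tnth_nth 0%R).
- exact: measurable_col_of_tuple.
- have mc : measurable_fun setT (fun u : 'cV[R]_n => col_mx (t%:M : 'cV_1) u).
    by apply: measurable_col_mx => //; exact: measurable_cst.
  exact: (measurableT_comp mf mc).
Qed.

Lemma integral_gauss1 (a c : R) : a != 0%R ->
  \int[leb]_t (expR (- 2^-1 * (a * t - c) ^+ 2))%:E =
  (Num.sqrt (2 * pi) / `|a|)%:E.
Proof.
move=> a0.
have s0 : (a^-1 != 0)%R by rewrite invr_eq0.
(* A multiple of the normal density of mean [c / a] and scale [a^-1]. A negative [a] is harmless,
   since the scale enters only through its square. *)
have E t : (expR (- 2^-1 * (a * t - c) ^+ 2))%:E =
    (Num.sqrt (2 * pi) / `|a|)%:E * (normal_pdf (c / a) a^-1 t)%:E.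
  rewrite normal_pdfE// -EFinM; congr EFin.
  rewrite /normal_peak /normal_fun [RHS]mulrA -[LHS]mul1r; congr (_ * expR _)%R.
    rewrite -mulrnAr (sqrtrM (pi *+ 2)%R (sqr_ge0 a^-1)) sqrtr_sqr normfV.
    rewrite invfM invrK.
    rewrite -[(pi *+ 2)%R]mulr_natl mulrA divfK ?normr_eq0// divff//.
    by rewrite gt_eqF// sqrtr_gt0 mulr_gt0 ?pi_gt0.
  by field.
under eq_integral do rewrite E.
rewrite ge0_integralZl_EFin//.
- by rewrite integral_normal_pdf mule1.
- by move=> t _; rewrite lee_fin normal_pdf_ge0.
- by apply/measurable_EFinP; exact: measurable_normal_pdf.
Qed.

(** The center [c] is generalized in the induction: once the first coordinate [t] is fixed, the
    center for the others depends on [t], but the value given by the induction hypothesis does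
    not. *)
Lemma integral_expR_sqnorm n (W : 'M[R]_n) (c : 'cV[R]_n) :
  is_trig_mx W -> \det W != 0%R ->
  \int[lebesgue_col R n]_u (expR (- 2^-1 * sqnorm (W *m u - c)))%:E =
  (Num.sqrt ((2 * pi) ^+ n) / `|\det W|)%:E.
Proof.
elim: n W c => [|n IHn] W c Wtrig W0.
  rewrite (eq_integral (cst 1)); last first.
    by move=> u _; rewrite sqnorm_sum big_ord0 mulr0 expR0.
  have leb1 : lebesgue_col R 0 setT = 1.
    by rewrite /lebesgue_col /pushforward preimage_setT; exact: diracT.
  rewrite integral_cst// [X in _ * X]leb1.
  by rewrite det_mx00 expr0 sqrtr1 normr1 divr1 mule1.
pose V : 'M[R]_(1 + n) := W.
have V0 : ursubmx V = 0%R.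
  apply/matrixP => i j; rewrite ursubmxEsub !mxE; apply/(is_trig_mxP Wtrig).
  by rewrite ord1.
have detV : (\det W = ulsubmx V 0 0 * \det (drsubmx V))%R.
  transitivity (\det V)%R => //.
  by rewrite -[in LHS](submxK V) V0 (det_lblock (ulsubmx V)) det_mx11.
move: W0; rewrite detV mulf_eq0 negb_or => /andP[a0 W0].
have Vtrig : is_trig_mx (drsubmx V) by exact: drsubmx_trig.
rewrite lebesgue_col_recl; last 2 first.
- apply: measurable_expR_sqnorm; apply: measurable_subr_mx.
    by apply: measurable_mulmx => //; exact: measurable_cst.
  exact: measurable_cst.
- by move=> u; rewrite lee_fin expR_ge0.
pose c' : 'cV[R]_(1 + n) := c.
transitivity (\int[leb]_t
    ((Num.sqrt ((2 * pi) ^+ n) / `|\det (drsubmx V)|)%:E *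
     (expR (- 2^-1 * (ulsubmx V 0 0 * t - usubmx c' 0 0) ^+ 2))%:E)).
  apply: eq_integral => t _.
  under eq_integral => u _.
    rewrite (@sqnorm_lblock _ 1 n V c')// mulrDr expRD EFinM; over.
  rewrite ge0_integralZl//; last first.
    apply: measurable_expR_sqnorm; apply: measurable_subr_mx.
      by apply: measurable_mulmx => //; exact: measurable_cst.
    exact: measurable_cst.
  rewrite IHn// muleC; congr (_ * (expR (_ * _))%:E).
  rewrite sqnorm_sum big_ord1 mxE; congr ((_ + _) ^+ 2)%R; last by rewrite mxE.
  by rewrite mxE big_ord1 [in X in (_ * X)%R]mxE mulr1n.
rewrite ge0_integralZl//; last first.
  apply/measurable_EFinP; apply: measurableT_comp => //.
  apply: measurable_funM => //.
  by apply: measurable_funX; exact: measurable_funB.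
rewrite integral_gauss1// -EFinM exprS normrM invfM.
rewrite (@sqrtrM _ (2 * pi)%R); last by rewrite mulr_ge0// pi_ge0.
by congr EFin; ring.
Qed.

(* The factor is triangular, so that the coordinates can be integrated out one
   at a time, without a linear change of variables. *)
Lemma integral_gauss_pdf_col_mx m n (mu : 'cV[R]_(m + n)) (S : 'M[R]_(m + n)) :
  is_upper S -> S \in unitmx ->
  \int[lebesgue_col R n]_y \int[lebesgue_col R m]_x
    (gauss_pdf mu (S^T *m S) (col_mx x y))%:E = 1.
Proof.
move=> Supper uS; have uST : S^T \in unitmx by rewrite unitmx_tr.
pose W := invmx S^T.
have Wtrig : is_trig_mx W by apply: (is_trig_mulmx1 Supper); rewrite mulmxV.
have W0 := ursubmx_trig (leqnn m) Wtrig.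
pose f (x : 'cV_m) y : R := gauss_pdf mu (S^T *m S) (col_mx x y).
have mf : measurable_fun setT (fun z : 'cV_n * 'cV_m => (f z.2 z.1)%:E).
  apply/measurable_EFinP; apply: measurable_gauss_pdf.
  exact: measurable_col_mx.
have f0 x y : (0 <= f x y)%R by exact: gauss_pdf_ge0.
(* The integrals are swapped: [W] is lower triangular, so the last block [y] has to be integrated
   first, at fixed [x]. *)
transitivity (\int[lebesgue_col R m]_x \int[lebesgue_col R n]_y (f x y)%:E).
  apply: (fubini_tonelli (fun z : 'cV_n * 'cV_m => (f z.2 z.1)%:E)) => // z.
  by rewrite lee_fin.
pose c := W *m mu.
pose K := ((Num.sqrt ((2 * pi) ^+ (m + n)) * `|\det S|)^-1)%R.
have K0 : (0 <= K)%R by rewrite invr_ge0 mulr_ge0// sqrtr_ge0.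
have fE x y : (f x y)%:E =
    (K * expR (- 2^-1 * sqnorm (ulsubmx W *m x - usubmx c)))%:E *
    (expR (- 2^-1 * sqnorm (drsubmx W *m y - (dsubmx c - dlsubmx W *m x))))%:E.
  rewrite -EFinM -mulrA -expRD -mulrDr -sqnorm_lblock// -mulmxBr.
  rewrite -(quad_invmx_mulmx (S := S))// /W mulKVmx//.
  rewrite /f /gauss_pdf; congr (_^-1 * _)%:E%R.
  rewrite det_mulmx det_tr -expr2 sqrtrM ?sqrtr_sqr//.
  by rewrite exprn_ge0// mulr_ge0// pi_ge0.
have detW : (\det W = \det (ulsubmx W) * \det (drsubmx W))%R.
  by rewrite -[in LHS](submxK W) W0 det_lblock.
have : \det W != 0%R.
  by rewrite /W det_inv det_tr invr_eq0 -unitfE -unitmxE.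
rewrite detW mulf_eq0 negb_or => /andP[ul0 dr0].
have mexp k p (A : 'M[R]_(k, p)) (b : 'cV[R]_k) : measurable_fun setT
    (fun u => (expR (- 2^-1 * sqnorm (A *m u - b)))%:E).
  apply: measurable_expR_sqnorm; apply: measurable_subr_mx.
    by apply: measurable_mulmx => //; exact: measurable_cst.
  exact: measurable_cst.
pose C := (Num.sqrt ((2 * pi) ^+ n) / `|\det (drsubmx W)|)%R.
transitivity (\int[lebesgue_col R m]_x ((K * C)%:E *
    (expR (- 2^-1 * sqnorm (ulsubmx W *m x - usubmx c)))%:E)).
  apply: eq_integral => x _.
  under eq_integral => y _ do rewrite fE.
  rewrite ge0_integralZl_EFin//; last 2 first.
  - exact: mexp.
  - by rewrite mulr_ge0 ?expR_ge0.
  rewrite integral_expR_sqnorm//; last exact: drsubmx_trig.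
  by rewrite -!EFinM mulrAC.
rewrite ge0_integralZl_EFin//; last 2 first.
- exact: mexp.
- by rewrite mulr_ge0// divr_ge0// sqrtr_ge0.
rewrite integral_expR_sqnorm//; last exact: ulsubmx_trig.
rewrite -!EFinM; congr EFin.
rewrite /K /C exprD (@sqrtrM _ ((2 * pi) ^+ m)%R); last first.
  by rewrite exprn_ge0// mulr_ge0// pi_ge0.
have -> : (`|\det S| = (`|\det (ulsubmx W)| * `|\det (drsubmx W)|)^-1)%R.
  by rewrite -normrM -detW /W det_inv det_tr normfV invrK.
have sqrt0 p : (Num.sqrt ((2 * pi : R) ^+ p) != 0)%R.
  by rewrite gt_eqF// sqrtr_gt0 exprn_gt0// mulr_gt0// pi_gt0.
have [um un] := (sqrt0 m, sqrt0 n).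
field.
by rewrite !normr_eq0 ul0 dr0 um un.
Qed.

End gaussian_integral.

(** * The information update *)

Section gram.
Context {R : realType}.

Lemma quad_gram n p (M : 'M[R]_(p, n)) (v : 'cV[R]_n) :
  quad (M^T *m M) v = sqnorm (M *m v).
Proof. by rewrite sqnormE /quad trmx_mul !mulmxA. Qed.

Lemma quadD n (M M' : 'M[R]_n) (v : 'cV[R]_n) :
  quad (M + M') v = quad M v + quad M' v.
Proof. by rewrite /quad mulmxDr mulmxDl mxE. Qed.

Lemma quad_subr n (M : 'M[R]_n) (u v : 'cV[R]_n) : M^T = M ->
  quad M (u - v) = quad M u - 2 * (u^T *m (M *m v)) 0 0 + quad M v.
Proof.
move=> Msym; have sym : (v^T *m M *m u) 0 0 = (u^T *m M *m v) 0 0.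
  by rewrite -[in LHS](trmxK (_ *m u)) mxE !trmx_mul trmxK Msym mulmxA.
rewrite /quad [(u - v)^T]linearB/= !mulmxBl !mulmxBr !mulmxA.
move: sym; set a := v^T *m M *m u; set b := u^T *m M *m v.
by rewrite !mxE => ->; ring.
Qed.

Lemma is_pd_unitmx n (M : 'M[R]_n) : is_pd M -> M \in unitmx.
Proof.
move=> [_ Mpos]; rewrite unitmxE unitfE; apply/det0P => -[v v0 vM].
have /Mpos : v^T != 0 by rewrite trmx_eq0.
by rewrite /quad trmxK vM mul0mx mxE ltxx.
Qed.

Lemma is_pd_gram n p (M : 'M[R]_(p, n)) :
  (forall v : 'cV_n, M *m v = 0 -> v = 0) -> is_pd (M^T *m M).
Proof.
move=> M0; split=> [|v v0]; first by rewrite trmx_mul trmxK.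
rewrite quad_gram lt_def sqnorm_ge0 sqnorm_eq0 andbT.
by apply: contraNN v0 => /eqP/M0 ->.
Qed.

Lemma is_pd_gram_unitmx n (S : 'M[R]_n) : S \in unitmx -> is_pd (S^T *m S).
Proof.
by move=> uS; apply: is_pd_gram => v Sv; rewrite -(mulKmx uS v) Sv mulmx0.
Qed.

Lemma is_sqrt_factor_unitmx n (S M : 'M[R]_n) :
  is_sqrt_factor S M -> M \in unitmx -> S \in unitmx.
Proof. by move=> [_ <-]; rewrite unitmx_mul => /andP[]. Qed.

Lemma is_upper_dlsubmx m n (M : 'M[R]_(m + n)) : is_upper M -> dlsubmx M = 0.
Proof.
move=> Mup; apply: trmx_inj; rewrite trmx_dlsub trmx0.
by rewrite (ursubmx_trig (leqnn m) Mup).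
Qed.

Lemma is_upper_drsubmx m n (M : 'M[R]_(m + n)) :
  is_upper M -> is_upper (drsubmx M).
Proof.
move=> Mup; rewrite /is_upper trmx_drsub.
exact: (drsubmx_trig (leqnn m) Mup).
Qed.

(* The lower-right block of the triangular factor performs the information
   update [P^-1 + K K^T] without inverting [P]. *)
Lemma qless_qr_drsubmx n (S K : 'M[R]_n) (F : 'M[R]_(n + n)) :
  S \in unitmx ->
  is_qless_qr F (block_mx 1%:M 0 (S *m K) S) ->
  (drsubmx F)^T *m drsubmx F *m (invmx (S^T *m S) + K *m K^T) = 1%:M.
Proof.
move=> uS [Fup [Q QQ FE]].
set P := S^T *m S.
have uP : P \in unitmx by rewrite unitmx_mul unitmx_tr uS.
have Psym : P^T = P by rewrite trmx_mul trmxK.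
(* The orthogonal factor cancels in [F^T F]. Comparing blocks gives [F11^T F11 = 1 + K^T P K],
   [F11^T F12 = K^T P] and [F12^T F12 + F22^T F22 = P]. *)
have : F^T *m F = (block_mx 1%:M 0 (S *m K) S)^T *m block_mx 1%:M 0 (S *m K) S.
  by rewrite FE trmx_mul mulmxA -(mulmxA _ Q^T) QQ mulmx1.
rewrite -[in LHS](submxK F) (is_upper_dlsubmx Fup) !tr_block_mx !mulmx_block.
rewrite !trmx0 !trmx1 !mul0mx !mulmx0 !add0r ?addr0 mul1mx.
set F11 := ulsubmx F; set F12 := ursubmx F; set F22 := drsubmx F.
move=> /eq_block_mx[E11 E12 _ E22].
(* [1 + K^T P K] is the Gram matrix of the column of blocks [1] and [S K], which is injective
   because of its first block. *)
have uF11 : F11 \in unitmx.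
  have : is_pd (F11^T *m F11).
    rewrite E11; pose M := col_mx (1%:M : 'M[R]_n) (S *m K).
    rewrite (_ : _ + _ = M^T *m M); last first.
      by rewrite /M tr_col_mx mul_row_col trmx1 mul1mx.
    apply: is_pd_gram => v; rewrite /M mul_col_mx mul1mx -(col_mx0 R n n 1).
    by move=> /eq_col_mx[].
  by move=> /is_pd_unitmx; rewrite unitmx_mul => /andP[].
have uF11T : F11^T \in unitmx by rewrite unitmx_tr.
set B := invmx F11^T.
have E12' : F12 = B *m K^T *m P.
  rewrite -(mulKmx uF11T F12) E12 trmx_mul /B /P !mulmxA.
  by [].
have -> : F22^T *m F22 = P - F12^T *m F12.
  by rewrite -/P in E22; rewrite -E22 addrAC subrr add0r.
have E11' : F11^T *m F11 = 1%:M + K^T *m P *m K.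
  by rewrite E11 trmx_mul /P !mulmxA.
have BF : B^T *m B *m (1%:M + K^T *m P *m K) = 1%:M.
  rewrite -E11' /B mulmxA -(mulmxA B^T) mulVmx// mulmx1.
  by rewrite /B trmx_inv trmxK mulVmx.
have -> : F12^T *m F12 = P *m K *m (B^T *m B) *m K^T *m P.
  by rewrite E12' trmx_mul Psym trmx_mul trmxK !mulmxA.
(* Now [F22^T F22 = P - P K (1 + K^T P K)^-1 K^T P], the Woodbury formula for the inverse of
   [P^-1 + K K^T]; it is checked by multiplying out. *)
rewrite mulmxBl mulmxDr mulmxV// -[_ *m P *m _]mulmxA mulmxDr mulmxV//.
have -> : P *m K *m (B^T *m B) *m K^T *m (1%:M + P *m (K *m K^T)) =
    P *m K *m (B^T *m B *m (1%:M + K^T *m P *m K)) *m K^T.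
  rewrite !mulmxDr !mulmxDl ?mulmx1 !mulmxA.
  by [].
by rewrite BF mulmx1 mulmxA addrK.
Qed.

End gram.

(** * Products of Gaussians and completing the square *)

Section gauss_pdf_algebra.
Context {R : realType}.

Lemma det_gram_gt0 n (S : 'M[R]_n) : S \in unitmx -> 0 < \det (S^T *m S).
Proof.
rewrite unitmxE unitfE => S0.
by rewrite det_mulmx det_tr -expr2 exprn_even_gt0.
Qed.

Lemma twopi_gt0 n : 0 < (2 * pi : R) ^+ n.
Proof. by rewrite exprn_gt0// mulr_gt0// pi_gt0. Qed.

(** Whitening both deviations by [S] and [Q] whitens the joint deviation by [U]: the terms in [A]
    cancel, so the exponents add, and [det U = det S det Q] matches the constants. *)
Lemma gauss_pdf_joint n (mu b x x' : 'cV[R]_n) (A S Q : 'M[R]_n) :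
  S \in unitmx -> Q \in unitmx ->
  let U := block_mx S (S *m A^T) 0 Q in
  gauss_pdf mu (S^T *m S) x * gauss_pdf (A *m x + b) (Q^T *m Q) x' =
  gauss_pdf (col_mx mu (A *m mu + b)) (U^T *m U) (col_mx x x').
Proof.
move=> uS uQ U.
have detU : \det U = \det S * \det Q by rewrite det_ublock.
have uU : U \in unitmx by rewrite unitmxE detU unitrM -!unitmxE uS.
pose w := invmx S^T *m (x - mu); pose w' := invmx Q^T *m (x' - (A *m x + b)).
have xw : x - mu = S^T *m w by rewrite mulKVmx// unitmx_tr.
have xw' : x' - (A *m x + b) = Q^T *m w' by rewrite mulKVmx// unitmx_tr.
have UW : col_mx x x' - col_mx mu (A *m mu + b) = U^T *m col_mx w w'.
  rewrite tr_block_mx trmx0 mul_block_col mul0mx addr0 trmx_mul trmxK.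
  rewrite -mulmxA -xw -xw' opp_col_mx add_col_mx mulmxBr; congr col_mx.
  by move: (A *m x) (A *m mu) => a c; apply/colP => k; rewrite !mxE; ring.
rewrite /gauss_pdf xw xw' UW !quad_invmx_mulmx// sqnorm_col_mx mulrACA -expRD.
rewrite -mulrDr -invfM; congr (_^-1 * _).
rewrite -sqrtrM; last by rewrite mulr_ge0// ltW ?twopi_gt0 ?det_gram_gt0.
congr (Num.sqrt _); rewrite !det_mulmx !det_tr detU exprD; ring.
Qed.

(** Completing the square: with [L' = L + H] and [L' mu' = L mu - eta], the terms in [u] agree on
    both sides, and the rest goes into the constant. [P'] is known only through a one-sided inverse,
    which is what the QR step delivers. *)
Lemma gauss_pdf_update n (P P' H : 'M[R]_n) (mu eta u : 'cV[R]_n) (r : R) :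
  P^T = P -> H^T = H -> 0 < \det P -> 0 < \det P' ->
  P' *m (invmx P + H) = 1%:M ->
  let mu' := P' *m (invmx P *m mu - eta) in
  gauss_pdf mu P u * expR (- 2^-1 * (r + 2 * (u^T *m eta) 0 0 + quad H u)) =
  Num.sqrt (\det P') / Num.sqrt (\det P) *
  expR (2^-1 * (quad (invmx P') mu' - quad (invmx P) mu - r)) *
  gauss_pdf mu' P' u.
Proof.
move=> Psym Hsym P0 P'0 P'E mu'.
set L := invmx P; set L' := invmx P'.
have Lsym : L^T = L by rewrite trmx_inv Psym.
have [uP' _] := mulmx1_unit P'E.
have L'E : L' = L + H by rewrite -(mulKmx uP' (L + H)) P'E mulmx1.
have L'sym : L'^T = L' by rewrite L'E linearD/= Lsym Hsym.
have L'mu : L' *m mu' = L *m mu - eta by rewrite mulKmx.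
rewrite /gauss_pdf -/L -/L' !quad_subr// L'mu.
have -> : quad L' u = quad L u + quad H u by rewrite L'E quadD.
have -> : (u^T *m (L *m mu - eta)) 0 0 =
    (u^T *m (L *m mu)) 0 0 - (u^T *m eta) 0 0.
  by rewrite mulmxBr !mxE.
rewrite -[LHS]mulrA -expRD [RHS]mulrACA -[X in _ = _ * X]expRD.
congr (_ * expR _).
  rewrite !sqrtrM ?ltW ?twopi_gt0//.
  have [s0 s1 s2] : [/\ Num.sqrt (\det P) != 0, Num.sqrt (\det P') != 0 &
      Num.sqrt ((2 * pi : R) ^+ n) != 0].
    by split; rewrite gt_eqF// sqrtr_gt0// twopi_gt0.
  by field; rewrite s1 s2 s0.
move: (quad L u) (quad H u) (quad L mu) (quad L' mu') => a b c e.
move: ((u^T *m (L *m mu)) 0 0) ((u^T *m eta) 0 0) => f g.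
by field.
Qed.

End gauss_pdf_algebra.

(** Euclidean division by [a] is the bijection behind [j = a * l + i]. The case [a = 0] is set
    apart: both sums are then empty. *)
Lemma sum_pair_index (R : realType) a b (f : 'I_a -> 'I_b -> R) :
  \sum_(j < a * b) f (fst_index j) (snd_index j) = \sum_i \sum_l f i l.
Proof.
case: a f => [|a] f; first by rewrite [RHS]big_ord0 big1// => -[].
rewrite pair_big/=.
rewrite (reindex (fun j : 'I_(a.+1 * b) => (fst_index j, snd_index j)))//.
have lt_il (il : 'I_a.+1 * 'I_b) : (a.+1 * il.2 + il.1 < a.+1 * b)%N.
  case: il => i l /=; rewrite (leq_trans (n := a.+1 * l.+1))//.
    by rewrite mulnS addnC ltn_add2r.
  by rewrite leq_pmul2l.
exists (fun il => Ordinal (lt_il il)) => [j|[i l]] _.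
  by apply/val_inj; rewrite /= mulnC -divn_eq.
by congr pair; apply/val_inj; rewrite /= mulnC ?modnMDl ?modn_small// divnMDl//
  divn_small// addn0.
Qed.

(** * The smoothed mixture as filtered density, transition and likelihood multiplied together *)

Section smoothing_step.
Context {R : realType} {n m : nat}.
Variables (T : 'M[R]_m) (D : transition R n m).
Variables (F : filtered_mixture R n m) (B : likelihood_mixture R n m).
Variable F_qr : smooth_index F B -> 'I_m -> 'I_m -> 'M[R]_((n + n) + (n + n)).
Hypothesis T_ge0 : forall j i, 0 <= T j i.
Hypothesis F_qrP : forall j z z',
  is_qless_qr (F_qr j z z') (smooth_qr_input D j z z').
Implicit Types (z : 'I_m) (j : smooth_index F B).

Lemma fm_sqrtP_unitmx (i : 'I_(fm_size F)) z : fm_sqrtP i z \in unitmx.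
Proof.
exact: is_sqrt_factor_unitmx (fm_sqrtPP i z) (is_pd_unitmx (fm_P_pd i z)).
Qed.

Lemma tr_sqrtQ_unitmx z : tr_sqrtQ D z \in unitmx.
Proof.
exact: is_sqrt_factor_unitmx (tr_sqrtQP D z) (is_pd_unitmx (tr_Q_pd D z)).
Qed.

Lemma pred_sqrtP_unitmx (i : 'I_(fm_size F)) z : pred_sqrtP D i z \in unitmx.
Proof.
rewrite unitmxE det_ublock unitrM -!unitmxE.
by rewrite fm_sqrtP_unitmx tr_sqrtQ_unitmx.
Qed.

Definition lik_info j z' : 'M[R]_(n + n) :=
  block_mx 0 0 0 (lm_L (lik_of j) z').

(** [smooth_J] factors as [pred_sqrtP] times [K = diag(0, (L^{1/2})^T)], which is the shape treated
    by [qless_qr_drsubmx], and [K K^T] is [lik_info]. *)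
Lemma smooth_P_info j z z' :
  smooth_P F_qr j z z' *m (invmx (pred_P D (filt_of j) z) + lik_info j z') =
  1%:M.
Proof.
pose K : 'M[R]_(n + n) := block_mx 0 0 0 (lm_sqrtL (lik_of j) z')^T.
have -> : lik_info j z' = K *m K^T.
  rewrite /K tr_block_mx !trmx0 trmxK mulmx_block !mulmx0 !mul0mx !add0r.
  by rewrite /lik_info; have [_ ->] := lm_sqrtLP (lik_of j) z'.
apply: qless_qr_drsubmx; first exact: pred_sqrtP_unitmx.
have := F_qrP j z z'; rewrite /smooth_qr_input.
have -> // : smooth_J D j z z' = pred_sqrtP D (filt_of j) z *m K.
by rewrite /K /pred_sqrtP mulmx_block !mulmx0 ?mul0mx !add0r.
Qed.

Lemma smooth_sqrtP_unitmx j z z' : smooth_sqrtP F_qr j z z' \in unitmx.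
Proof.
have [] := mulmx1_unit (smooth_P_info j z z').
by rewrite unitmx_mul => /andP[].
Qed.

Lemma smooth_P_pd j z z' : is_pd (smooth_P F_qr j z z').
Proof. exact/is_pd_gram_unitmx/smooth_sqrtP_unitmx. Qed.

Lemma smooth_sqrtP_upper j z z' : is_upper (smooth_sqrtP F_qr j z z').
Proof. by have [/is_upper_drsubmx] := F_qrP j z z'. Qed.

Lemma smooth_wtildeE j z z' :
  smooth_wtilde T D F_qr j z z' =
  fm_w (filt_of j) z * T z' z *
  (Num.sqrt (\det (smooth_P F_qr j z z')) /
   Num.sqrt (\det (pred_P D (filt_of j) z)) *
   expR (2^-1 * (quad (invmx (smooth_P F_qr j z z')) (smooth_mu D F_qr j z z')
     - quad (invmx (pred_P D (filt_of j) z)) (pred_mu D (filt_of j) z)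
     - lm_r (lik_of j) z'))).
Proof.
have dP' : 0 < \det (smooth_P F_qr j z z').
  by rewrite det_gram_gt0// smooth_sqrtP_unitmx.
have dP : 0 < \det (pred_P D (filt_of j) z).
  by rewrite det_gram_gt0// pred_sqrtP_unitmx.
rewrite /smooth_wtilde /smooth_beta.
set q' := quad _ (smooth_mu _ _ _ _ _); set q := quad _ (pred_mu _ _ _).
set r := lm_r _ _; set d' := \det (smooth_P _ _ _ _).
set d := \det (pred_P _ _ _).
rewrite !(lne_EFin dP') !(lne_EFin dP).
have half0 : (0 < (2^-1 : R)%:E)%E by rewrite lte_fin invr_gt0.
(* A vanishing weight contributes [-oo], which absorbs the remaining terms of [smooth_beta]; the
   exponential then returns 0. The same happens below for a vanishing transition probability. *)
have [w0|w0] := leP (fm_w (filt_of j) z) 0.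
  have -> : fm_w (filt_of j) z = 0 by apply/le_anti; rewrite w0 fm_w_ge0.
  rewrite le0_lneNy// gt0_muleNy ?lte_fin// addeNy !addNye gt0_muleNy//=.
  by rewrite !mul0r.
rewrite (lne_EFin w0).
have [t0|t0] := leP (T z' z) 0.
  have -> : T z' z = 0 by apply/le_anti; rewrite t0 T_ge0.
  rewrite le0_lneNy// gt0_muleNy ?lte_fin// addeNy !addNye gt0_muleNy//=.
  by rewrite mulr0 !mul0r.
rewrite (lne_EFin t0)/=.
(* The factor one half turns the log-determinants into square roots; for the weight and the
   transition probability it is compensated by the factor 2 in [smooth_beta]. *)
have expR_half_ln (y : R) : 0 < y -> expR (2^-1 * ln y) = Num.sqrt y.
  move=> y0; apply/eqP; rewrite -(eqrXn2 (n := 2)) ?expR_ge0 ?sqrtr_ge0//.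
  by rewrite sqr_sqrtr ?ltW// -expRM_natl mulrA divff// mul1r lnK.
rewrite -!expR_half_ln// -expRN -!expRD.
rewrite -[X in X * T _ _](lnK w0) -[X in _ * X * _](lnK t0) -!expRD.
by congr expR; field.
Qed.

Lemma smooth_term j z z' x x' :
  smooth_wtilde T D F_qr j z z' *
  gauss_pdf (smooth_mu D F_qr j z z') (smooth_P F_qr j z z') (col_mx x x') =
  fm_w (filt_of j) z * gauss_pdf (fm_mu (filt_of j) z) (fm_P (filt_of j) z) x *
  transition_pdf T D (x, z) (x', z') *
  quad_likelihood (lm_r (lik_of j) z') (lm_s (lik_of j) z')
    (lm_L (lik_of j) z') x'.
Proof.
set i := filt_of j; set l := lik_of j.
have [_ <-] := fm_sqrtPP i z; rewrite /transition_pdf/=.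
have [_ <-] := tr_sqrtQP D z.
rewrite [X in _ = X * _]mulrACA.
rewrite gauss_pdf_joint ?fm_sqrtP_unitmx ?tr_sqrtQ_unitmx//.
rewrite smooth_wtildeE -[LHS]mulrA -[RHS]mulrA; congr (_ * _).
(* The likelihood of [x'] alone is read as a quadratic likelihood of the stacked vector, so that it
   can update the joint Gaussian. *)
have -> : quad_likelihood (lm_r l z') (lm_s l z') (lm_L l z') x' =
    expR (- 2^-1 * (lm_r l z' +
      2 * ((col_mx x x')^T *m (col_mx 0 (lm_s l z') : 'cV_(n + n))) 0 0 +
      quad (lik_info j z') (col_mx x x'))).
  rewrite /quad_likelihood tr_col_mx mul_row_col mulmx0 add0r.
  rewrite /quad /lik_info tr_col_mx -/l mul_row_block !mulmx0 !add0r.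
  by rewrite mul_row_col mul0mx add0r.
symmetry.
apply: (@gauss_pdf_update _ _ (pred_P D i z) (smooth_P F_qr j z z')
  (lik_info j z')).
- by rewrite trmx_mul trmxK.
- rewrite /lik_info tr_block_mx !trmx0.
  by have [-> _] := lm_L_psd (lik_of j) z'.
- by rewrite det_gram_gt0// pred_sqrtP_unitmx.
- by rewrite det_gram_gt0// smooth_sqrtP_unitmx.
- exact: smooth_P_info.
Qed.

Lemma sum_smooth_term z z' x x' :
  \sum_j smooth_wtilde T D F_qr j z z' *
    gauss_pdf (smooth_mu D F_qr j z z') (smooth_P F_qr j z z') (col_mx x x') =
  filtered_pdf F (x, z) * transition_pdf T D (x, z) (x', z') *
  likelihood_pdf B (x', z').
Proof.
under eq_bigr do rewrite smooth_term.
rewrite (sum_pair_index (fun i l => fm_w i z *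
  gauss_pdf (fm_mu i z) (fm_P i z) x * transition_pdf T D (x, z) (x', z') *
  quad_likelihood (lm_r l z') (lm_s l z') (lm_L l z') x')).
rewrite /filtered_pdf /likelihood_pdf !mulr_suml; apply: eq_bigr => i _.
by rewrite mulr_sumr.
Qed.

Lemma smoothed_pdfE z z' x x' :
  smoothed_pdf T D F_qr ((x', z'), (x, z)) =
  filtered_pdf F (x, z) * transition_pdf T D (x, z) (x', z') *
  likelihood_pdf B (x', z') /
  \sum_(z1 < m) \sum_(z0 < m) \sum_j smooth_wtilde T D F_qr j z0 z1.
Proof.
rewrite -sum_smooth_term mulr_suml; apply: eq_bigr => j _.
by rewrite /smooth_w mulrAC.
Qed.

Lemma smooth_wtilde_ge0 j z z' : 0 <= smooth_wtilde T D F_qr j z z'.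
Proof. by rewrite fine_ge0// expeR_ge0. Qed.

End smoothing_step.

(** * The joint smoothed density *)

Section hybrid_integral.
Context {R : realType}.
Local Open Scope ereal_scope.

Lemma integral_counting_mode m (f : 'I_m.+1 -> \bar R) : (forall z, 0 <= f z) ->
  \int[@counting 'I_m.+1 R]_z f z = \sum_z f z.
Proof.
move=> f0.
have count1 z : @counting 'I_m.+1 R [set z] = 1.
  rewrite /counting asboolT; last exact: finite_set1.
  by rewrite fset_set1 finmap.cardfs1.
have cover : [set: 'I_m.+1] = \big[setU/set0]_(z <- enum 'I_m.+1) [set z].
  rewrite -bigcup_seq; apply/seteqP; split => // z _.
  by exists z => //=; rewrite mem_enum.
rewrite cover (@ge0_integral_bigsetU _ _ _ _ _ (fun z : 'I_m.+1 => [set z]))//=.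
- rewrite big_enum; apply: eq_bigr => z _.
  rewrite (eq_integral (cst (f z))); last by move=> x /[!inE] ->.
  by rewrite integral_cst// [X in _ * X]count1 mule1.
- exact: enum_uniq.
- by move=> i j _ _ [x [-> ->]].
Qed.

Lemma integral_hybrid n m (f : 'cV[R]_n * 'I_m.+1 -> \bar R) :
  measurable_fun setT f -> (forall v, 0 <= f v) ->
  \int[hybrid_measure R n m]_v f v =
  \sum_z \int[lebesgue_col R n]_x f (x, z).
Proof.
move=> mf f0.
rewrite -(integral_counting_mode
  (f := fun z => \int[lebesgue_col R n]_x f (x, z))).
  exact: (fubini_tonelli2 (m1 := lebesgue_col R n)
    (m2 := @counting 'I_m.+1 R) f).
by move=> z; exact: integral_ge0.
Qed.

End hybrid_integral.

Section smoothing_normalization.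
Context {R : realType} {n m : nat}.
Variables (T : 'M[R]_m.+1) (D : transition R n m.+1).
Variables (F : filtered_mixture R n m.+1) (B : likelihood_mixture R n m.+1).
Variable F_qr :
  smooth_index F B -> 'I_m.+1 -> 'I_m.+1 -> 'M[R]_((n + n) + (n + n)).
Hypothesis T_ge0 : forall j i, 0 <= T j i.
Hypothesis F_qrP : forall j z z',
  is_qless_qr (F_qr j z z') (smooth_qr_input D j z z').

Lemma filtered_pdf_ge0 v : 0 <= filtered_pdf F v.
Proof.
by apply: sumr_ge0 => i _; rewrite mulr_ge0 ?fm_w_ge0// gauss_pdf_ge0.
Qed.

Lemma transition_pdf_ge0 v v' : 0 <= transition_pdf T D v v'.
Proof. by rewrite mulr_ge0// gauss_pdf_ge0. Qed.

Lemma likelihood_pdf_ge0 v : 0 <= likelihood_pdf B v.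
Proof. by apply: sumr_ge0 => i _; exact: expR_ge0. Qed.

Lemma integral_smooth :
  let q (v : ('cV[R]_n * 'I_m.+1) * ('cV[R]_n * 'I_m.+1)) :=
    filtered_pdf F v.2 * transition_pdf T D v.2 v.1 * likelihood_pdf B v.1 in
  measurable_fun setT q ->
  (\int[prod_sigma_finite (hybrid_measure R n m) (hybrid_measure R n m)]_v
     (q v)%:E =
   (\sum_(z1 < m.+1) \sum_(z0 < m.+1) \sum_j
      smooth_wtilde T D F_qr j z0 z1)%:E)%E.
Proof.
move=> q mq.
have q0 v : 0 <= q v.
  rewrite mulr_ge0 ?likelihood_pdf_ge0//.
  by rewrite mulr_ge0 ?filtered_pdf_ge0 ?transition_pdf_ge0.
have mqE : measurable_fun setT (EFin \o q) by exact/measurable_EFinP.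
rewrite prod_tonelli1//.
rewrite integral_hybrid; last 2 first.
- exact: (measurable_fun_fubini_tonelli_F (m2 := hybrid_measure R n m)
    (EFin \o q)).
- by move=> v; apply: integral_ge0 => w _; rewrite lee_fin.
rewrite -sumEFin; apply: eq_bigr => z' _.
pose g j z (x x' : 'cV[R]_n) :=
  gauss_pdf (smooth_mu D F_qr j z z') (smooth_P F_qr j z z') (col_mx x x').
have mg j z : measurable_fun setT
    (fun v : 'cV[R]_n * 'cV[R]_n => (g j z v.2 v.1)%:E).
  by apply/measurable_EFinP/measurable_gauss_pdf; exact: measurable_col_mx.
have g0 j z x x' : (0 <= (g j z x x')%:E)%E by rewrite lee_fin gauss_pdf_ge0.
have mG j z : measurable_fun setT
    (fun x' => \int[lebesgue_col R n]_x (g j z x x')%:E)%E.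
  exact: (measurable_fun_fubini_tonelli_F (m2 := lebesgue_col R n)
    (fun v : 'cV[R]_n * 'cV[R]_n => (g j z v.2 v.1)%:E)).
have G0 j z x' : (0 <= \int[lebesgue_col R n]_x (g j z x x')%:E)%E.
  exact: integral_ge0.
transitivity (\int[lebesgue_col R n]_x' \sum_z \sum_j
    ((smooth_wtilde T D F_qr j z z')%:E *
     \int[lebesgue_col R n]_x (g j z x x')%:E))%E.
  apply: eq_integral => x' _.
  rewrite integral_hybrid; last 2 first.
  - exact: (measurableT_comp mqE (pair1_measurable (x', z'))).
  - by move=> v; rewrite lee_fin.
  apply: eq_bigr => z _.
  transitivity (\int[lebesgue_col R n]_x \sum_j
    ((smooth_wtilde T D F_qr j z z')%:E * (g j z x x')%:E))%E.
    apply: eq_integral => x _.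
    rewrite /q -(sum_smooth_term T_ge0 F_qrP) -sumEFin.
    by apply: eq_bigr.
  have mgx' j : measurable_fun setT (fun x => (g j z x x')%:E).
    exact: (measurableT_comp (mg j z) (pair1_measurable x')).
  rewrite ge0_integral_sum//; last 2 first.
  - by move=> j; exact: measurable_funeM.
  - by move=> j x _; rewrite mule_ge0// lee_fin smooth_wtilde_ge0.
  apply: eq_bigr => j _; rewrite ge0_integralZl_EFin//.
  exact: smooth_wtilde_ge0.
rewrite ge0_integral_sum//; last 2 first.
- move=> z; apply: emeasurable_sum => j; exact: measurable_funeM.
- move=> z x' _; apply: sume_ge0 => j _.
  by rewrite mule_ge0// lee_fin smooth_wtilde_ge0.
rewrite -sumEFin; apply: eq_bigr => z _.
rewrite ge0_integral_sum//; last 2 first.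
- by move=> j; exact: measurable_funeM.
- by move=> j x' _; rewrite mule_ge0// lee_fin smooth_wtilde_ge0.
rewrite -sumEFin; apply: eq_bigr => j _.
rewrite ge0_integralZl_EFin ?smooth_wtilde_ge0//.
(* Here the triangular shape of [R_22] matters, beyond its being a factor of the covariance. *)
rewrite [X in (_ * X)%E]integral_gauss_pdf_col_mx ?mule1//.
- exact: (smooth_sqrtP_upper F_qrP).
- exact: (smooth_sqrtP_unitmx F_qrP).
Qed.

End smoothing_normalization.

(** * Windows of a process, and splitting the record at time [k] *)

Section windows.
Context d (T : measurableType d).

Lemma measurable_window d' (Om : measurableType d') (U : nat -> Om -> T) a n :
  (forall i, measurable_fun setT (U i)) -> measurable_fun setT (window U a n).
Proof.
move=> mU; apply/measurable_fun_tnthP => i.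
rewrite (_ : _ \o _ = U (a + i)%N)//.
by apply/funext => w /=; rewrite tnth_mktuple.
Qed.

Lemma measurable_nth_tuple x0 n i :
  measurable_fun setT (fun t : n.-tuple T => nth x0 t i).
Proof.
have [ni|ltin] := leqP n i.
  rewrite (_ : (fun _ => _) = cst x0); first exact: measurable_cst.
  by apply/funext => t; rewrite nth_default// size_tuple.
rewrite (_ : (fun _ => _) = (fun t => tnth t (Ordinal ltin))).
  exact: measurable_tnth.
by apply/funext => t; rewrite (tnth_nth x0).
Qed.

Lemma nth_window d' (Om : measurableType d') (U : nat -> Om -> T) a n w x0 i :
  (i < n)%N -> nth x0 (window U a n w) i = U (a + i)%N w.
Proof.
by move=> ltin; rewrite -(tnth_nth x0 _ (Ordinal ltin)) tnth_mktuple.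
Qed.

Lemma last_window d' (Om : measurableType d') (U : nat -> Om -> T) n w x0 :
  (0 < n)%N -> last x0 (window U 1 n w) = U n w.
Proof.
by move=> n0; rewrite -nth_last size_tuple nth_window ?prednK// add1n prednK.
Qed.

Lemma measurable_last_tuple x0 n :
  measurable_fun setT (fun t : n.-tuple T => last x0 t).
Proof.
rewrite (_ : (fun _ => _) = (fun t : n.-tuple T => nth x0 t n.-1)).
  exact: measurable_nth_tuple.
by apply/funext => t; rewrite -nth_last size_tuple.
Qed.

End windows.

Section concatenation.
Context (R : realType) (p N k : nat).
Hypothesis kN : (k < N)%N.
Local Notation V := 'cV[R]_p.

(** Entries are read off by [nth], since plain concatenation would have length [k + (N - k)], which
    is not convertible to [N]. *)
Definition cat_record (yy : k.-tuple V * (N - k).-tuple V) : N.-tuple V :=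
  [tuple nth 0 (yy.1 ++ yy.2) i | i < N].

Definition split_record (y : N.-tuple V) : k.-tuple V * (N - k).-tuple V :=
  (subtuple y 0 k, subtuple y k (N - k)).

Lemma nth_subtuple (y : N.-tuple V) a n i :
  (i < n)%N -> nth 0 (subtuple y a n) i = nth 0 y (a + i)%N.
Proof. by move=> ltin; rewrite -(tnth_nth 0 _ (Ordinal ltin)) tnth_mktuple. Qed.

Lemma nth_cat_record yy i : (i < N)%N ->
  nth 0 (cat_record yy) i = nth 0 (yy.1 ++ yy.2) i.
Proof. by move=> ltin; rewrite -(tnth_nth 0 _ (Ordinal ltin)) tnth_mktuple. Qed.

Lemma split_recordK : cancel split_record cat_record.
Proof.
move=> y; apply: eq_from_tnth => i; rewrite !(tnth_nth 0) nth_cat_record//.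
rewrite nth_cat size_tuple; case: ltnP => ik.
  by rewrite nth_subtuple.
by rewrite nth_subtuple ?ltn_sub2r// subnKC.
Qed.

Lemma cat_recordK : cancel cat_record split_record.
Proof.
move=> [y1 y2]; congr pair; apply: eq_from_tnth => i; rewrite !(tnth_nth 0).
  rewrite nth_subtuple// nth_cat_record; last exact: ltn_trans (ltn_ord i) kN.
  by rewrite nth_cat size_tuple add0n ltn_ord.
have kiN : (k + i < N)%N by rewrite -ltn_subRL.
rewrite nth_subtuple// nth_cat_record// nth_cat size_tuple.
by rewrite ltnNge leq_addr/= addKn.
Qed.

Lemma measurable_cat_record : measurable_fun setT cat_record.
Proof.
apply/measurable_fun_tnthP => i.
rewrite (_ : _ \o _ =
    fun yy : k.-tuple V * (N - k).-tuple V => if (i < k)%N then nth 0 yy.1 i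
                                else nth 0 yy.2 (i - k)%N).
  case: (i < k)%N.
    apply: (measurableT_comp (@measurable_nth_tuple _ V 0 k i)).
    exact: measurable_fst.
  apply: (measurableT_comp (@measurable_nth_tuple _ V 0 (N - k) (i - k))).
  exact: measurable_snd.
by apply/funext => yy /=; rewrite tnth_mktuple nth_cat size_tuple.
Qed.

Lemma measurable_subtuple a n :
  measurable_fun setT (fun y : N.-tuple V => subtuple y a n).
Proof.
apply/measurable_fun_tnthP => i.
rewrite (_ : _ \o _ = fun y : N.-tuple V => nth 0 y (a + i)%N).
  exact: measurable_nth_tuple.
by apply/funext => y /=; rewrite tnth_mktuple.
Qed.

Lemma measurable_split_record : measurable_fun setT split_record.
Proof. by apply: measurable_fun_pair; exact: measurable_subtuple. Qed.

Lemma cat_record_window d (Om : measurableType d) (Y : nat -> Om -> V) w :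
  cat_record (window Y 1 k w, window Y k.+1 (N - k) w) = window Y 1 N w.
Proof.
apply: (can_inj split_recordK); rewrite cat_recordK.
congr pair; apply: eq_from_tnth => i; rewrite !tnth_mktuple nth_window//.
  exact: ltn_trans (ltn_ord i) kN.
by rewrite -ltn_subRL.
Qed.

End concatenation.

Unset Implicit Arguments.

Theorem lemma3p1 (R : realType) (nx ny m N k : nat)
  (k_gt0 : (0 < k)%N) (k_lt_N : (k < N)%N)
  (d : measure_display) (Om : measurableType d) (P : probability Om R)
  (X : nat -> {RV P >-> 'cV[R]_nx})
  (Z : nat -> {RV P >-> 'I_m.+1})
  (Y : nat -> {RV P >-> 'cV[R]_ny})
  (T : 'M[R]_m.+1) (T_stoch : is_transition_matrix T)
  (D : 'cV[R]_ny -> transition R nx m.+1)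
  (filt : k.-tuple 'cV[R]_ny -> filtered_mixture R nx m.+1)
  (lik : (N - k).-tuple 'cV[R]_ny -> likelihood_mixture R nx m.+1)
  (* hybrid transition model, given x_{1:k}, z_{1:k}, y_{1:k} *)
  (transitionP : cond_density P
    (fun w => (window X 1 k w, window Z 1 k w, window Y 1 k w))
    (fun w => (X k.+1 w, Z k.+1 w))
    (hybrid_measure R nx m)
    (fun h v => transition_pdf T (D (last 0 h.2))
                  (last 0 h.1.1, last ord0 h.1.2) v))
  (* y_{k+1:N} depends on x_{1:k+1}, z_{1:k+1}, y_{1:k} only through
     x_{k+1}, z_{k+1} *)
  (observationP : cond_depends_only P
    (fun w => (window X 1 k.+1 w, window Z 1 k.+1 w, window Y 1 k w))
    (fun w => (X k.+1 w, Z k.+1 w))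
    (window Y k.+1 (N - k)))
  (* p(x_k, z_k | y_{1:k}) *)
  (filteredP : cond_density P
    (window Y 1 k)
    (fun w => (X k w, Z k w))
    (hybrid_measure R nx m)
    (fun y v => filtered_pdf (filt y) v))
  (* p(y_{k+1:N} | x_{k+1}, z_{k+1}) *)
  (likelihoodP : cond_density P
    (fun w => (X k.+1 w, Z k.+1 w))
    (window Y k.+1 (N - k))
    (tuple_measure (lebesgue_col R ny) (N - k))
    (fun v y => likelihood_pdf (lik y) v))
  (* the upper triangular QR factors, for each data record y = y_{1:N} *)
  (F_qr : forall y : N.-tuple 'cV[R]_ny,
     smooth_index (filt (subtuple y 0 k)) (lik (subtuple y k (N - k))) ->
     'I_m.+1 -> 'I_m.+1 -> 'M[R]_((nx + nx) + (nx + nx)))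
  (F_qrP : forall y j z z', is_qless_qr (F_qr y j z z')
     (smooth_qr_input (D (nth 0 y k.-1)) j z z')) :
  (forall y j z z',
     is_pd (smooth_P (F_qr y) j z z') /\
     is_sqrt_factor (smooth_sqrtP (F_qr y) j z z')
                    (smooth_P (F_qr y) j z z')) /\
  cond_density P
    (window Y 1 N)
    (fun w => ((X k.+1 w, Z k.+1 w), (X k w, Z k w)))
    (hybrid_measure R nx m \x hybrid_measure R nx m)%E
    (fun y v => smoothed_pdf T (D (nth 0 y k.-1)) (F_qr y) v).
Proof.
have [T0 _] := T_stoch.
have k1_lt : (k.-1 < k)%N by rewrite prednK.
split=> [y j z z'|].
  split; first exact: (smooth_P_pd (F_qrP y)).
  by split => //; exact: (smooth_sqrtP_upper (F_qrP y)).
have mX i : measurable_fun setT (X i) by exact: measurable_funPT.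
have mZ i : measurable_fun setT (Z i) by exact: measurable_funPT.
have mY i : measurable_fun setT (Y i) by exact: measurable_funPT.
set U := window Y 1 k; set W := window Y k.+1 (N - k).
pose V w := (X k w, Z k w); pose S w := (X k.+1 w, Z k.+1 w).
have mU : measurable_fun setT U by exact: measurable_window.
have mW : measurable_fun setT W by exact: measurable_window.
have mV : measurable_fun setT V by exact: measurable_fun_pair.
have mS : measurable_fun setT S by exact: measurable_fun_pair.
have mSV : measurable_fun setT (fun w => (S w, V w)).
  exact: measurable_fun_pair.
have tr : cond_density P (fun w => (U w, V w)) S (hybrid_measure R nx m)
    (fun u s => transition_pdf T (D (last 0 u.1)) u.2 s).
  pose g (h : k.-tuple 'cV[R]_nx * k.-tuple 'I_m.+1 * k.-tuple 'cV[R]_ny) :=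
    (h.2, (last 0 h.1.1, last ord0 h.1.2)).
  (* Constant histories give a section of [g]; as [k > 0], the last entry of such a history is the
     given value. *)
  pose c (u : k.-tuple 'cV[R]_ny * ('cV[R]_nx * 'I_m.+1)) :=
    ([tuple u.2.1 | _ < k], [tuple u.2.2 | _ < k], u.1).
  have last_cst (A : Type) (a x0 : A) : last x0 [tuple a | _ < k] = a.
    rewrite -nth_last size_tuple -(tnth_nth x0 _ (Ordinal k1_lt)).
    exact: tnth_mktuple.
  have cK : cancel c g.
    by move=> [y1 [x z]]; rewrite /g /c/= !last_cst.
  have mg : measurable_fun setT g.
    apply: measurable_fun_pair => //; apply: measurable_fun_pair.
      apply: (measurableT_comp (@measurable_last_tuple _ 'cV[R]_nx 0 k)).
      exact: (measurableT_comp measurable_fst measurable_fst).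
    apply: (measurableT_comp (@measurable_last_tuple _ 'I_m.+1 ord0 k)).
    exact: (measurableT_comp measurable_snd measurable_fst).
  have mc : measurable_fun setT c.
    apply: measurable_fun_pair => //; apply: measurable_fun_pair.
      apply/measurable_fun_tnthP => i.
      rewrite (_ : _ \o _ = fst \o snd); last first.
        by apply/funext => u /=; rewrite tnth_mktuple.
      exact: (measurableT_comp measurable_fst measurable_snd).
    apply/measurable_fun_tnthP => i.
    rewrite (_ : _ \o _ = snd \o snd); last first.
      by apply/funext => u /=; rewrite tnth_mktuple.
    exact: (measurableT_comp measurable_snd measurable_snd).
  have -> : (fun w => (U w, V w)) = g \o
      (fun w => (window X 1 k w, window Z 1 k w, window Y 1 k w)).
    apply/funext => w; congr (_, (_, _)); rewrite last_window//.
  exact: (cond_density_comp_section mg mc cK transitionP).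
have ob : cond_density P (fun w => (U w, (S w, V w))) W
    (tuple_measure (lebesgue_col R ny) (N - k))
    (fun u y => likelihood_pdf (lik y) u.2.1).
  pose h w := (window X 1 k.+1 w, window Z 1 k.+1 w, window Y 1 k w).
  pose s (h : k.+1.-tuple 'cV[R]_nx * k.+1.-tuple 'I_m.+1 * k.-tuple 'cV[R]_ny)
    := (last 0 h.1.1, last ord0 h.1.2).
  have Sh : S = s \o h.
    by apply/funext => w; congr pair; rewrite last_window.
  have mh : measurable_fun setT h.
    by do 2?[apply: measurable_fun_pair]; exact: measurable_window.
  have ms : measurable_fun setT s.
    apply: measurable_fun_pair.
      apply: (measurableT_comp (@measurable_last_tuple _ 'cV[R]_nx 0 k.+1)).
      exact: (measurableT_comp measurable_fst measurable_fst).
    apply: (measurableT_comp (@measurable_last_tuple _ 'I_m.+1 ord0 k.+1)).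
    exact: (measurableT_comp measurable_snd measurable_fst).
  (* The likelihood is first refined to the whole history [h], then coarsened to
     [(y_{1:k}, states at k + 1 and k)]. *)
  have := cond_depends_density mh mW ms.
  rewrite -Sh => /(_ R P _ _ observationP likelihoodP) hW.
  (* In a window of length [k + 1] starting at time 1, position [k.-1] holds time [k] and the last
     position holds time [k + 1]. *)
  pose g (h : k.+1.-tuple 'cV[R]_nx * k.+1.-tuple 'I_m.+1 * k.-tuple 'cV[R]_ny)
    := (h.2, (s h, (nth 0 h.1.1 k.-1, nth ord0 h.1.2 k.-1))).
  have -> : (fun w => (U w, (S w, V w))) = g \o h.
    apply/funext => w; congr (_, (_, (_, _))); first by rewrite Sh.
      by rewrite nth_window ?add1n ?prednK// ltnS leq_pred.
    by rewrite nth_window ?add1n ?prednK// ltnS leq_pred.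
  apply: cond_density_comp => //.
  - apply: measurable_fun_pair => //; apply: measurable_fun_pair => //.
    apply: measurable_fun_pair.
      apply: (measurableT_comp (@measurable_nth_tuple _ 'cV[R]_nx 0 k.+1 k.-1)).
      exact: (measurableT_comp measurable_fst measurable_fst).
    apply: (measurableT_comp (@measurable_nth_tuple _ 'I_m.+1 ord0 k.+1 k.-1)).
    exact: (measurableT_comp measurable_snd measurable_fst).
  - have [mf _ _] := likelihoodP.
    pose e (x : (k.-tuple 'cV[R]_ny * (('cV[R]_nx * 'I_m.+1) *
      ('cV[R]_nx * 'I_m.+1))) * (N - k).-tuple 'cV[R]_ny) := (x.1.2.1, x.2).
    have me : measurable_fun setT e.
      apply: measurable_fun_pair => //.
      apply: (measurableT_comp measurable_fst).
      exact: (measurableT_comp measurable_snd measurable_fst).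
    exact: (measurableT_comp mf me).
  - by move=> u v; exact: likelihood_pdf_ge0.
have USV := cond_density_chain mU mV mS filteredP tr.
have UWSV := cond_density_chain mU mSV mW USV ob.
pose y uw : N.-tuple 'cV[R]_ny := cat_record (k := k) uw.
have y1 uw : subtuple (y uw) 0 k = uw.1.
  by have /(congr1 fst) := cat_recordK k_lt_N uw.
have y2 uw : subtuple (y uw) k (N - k) = uw.2.
  by have /(congr1 snd) := cat_recordK k_lt_N uw.
have yk uw : nth 0 (y uw) k.-1 = last 0 uw.1.
  rewrite -[k.-1]add0n -(nth_subtuple (y uw) 0 k1_lt) y1.
  by rewrite -nth_last size_tuple.
(* The predictive density of [y_{k+1:N}] given [y_{1:k}], as the sum of unnormalized weights at the
   reassembled record. *)
pose G (u : k.-tuple 'cV[R]_ny) (w : (N - k).-tuple 'cV[R]_ny) : R :=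
  \sum_(z1 < m.+1) \sum_(z0 < m.+1) \sum_j
    smooth_wtilde T (D (nth 0 (y (u, w)) k.-1)) (F_qr (y (u, w))) j z0 z1.
have bay := cond_density_bayes (g := G) mU mSV mW UWSV.
have GE u w : (\int[prod_sigma_finite (hybrid_measure R nx m)
    (hybrid_measure R nx m)]_v (filtered_pdf (filt u) v.2 *
      transition_pdf T (D (last 0 u)) v.2 v.1 *
      likelihood_pdf (lik w) v.1)%:E = (G u w)%:E)%E.
  (* The type of [F_qr] mentions the subtuples of [y (u, w)], so [y1] and [y2] can be rewritten only
     after [integral_smooth] has removed [F_qr]. [smoothed_pdfE] exposes the same product at the
     end. *)
  rewrite /G -(integral_smooth T0 (F_qrP (y (u, w)))) ?y1 ?y2 ?yk//.
  have [mq _ _] := UWSV.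
  exact: (measurableT_comp (measurableT_comp mq (pair1_measurable u))
    (pair1_measurable w)).
have {bay}smoothP := bay GE.
have -> : (window Y 1 N : Om -> N.-tuple 'cV[R]_ny) =
    y \o (fun w => (U w, W w)).
  by apply/funext => w; rewrite /y/= cat_record_window.
(* Conditioning passes from the pair [(y_{1:k}, y_{k+1:N})] to the single record; splitting the
   record is the section. *)
apply: (cond_density_comp_section (c := @split_record R ny N k)).
- exact: measurable_cat_record.
- exact: measurable_split_record.
- exact: split_recordK.
suff -> : (fun uw => smoothed_pdf T (D (nth 0 (y uw) k.-1)) (F_qr (y uw))) =
    (fun uw v => filtered_pdf (filt uw.1) v.2 *
      transition_pdf T (D (last 0 uw.1)) v.2 v.1 *
      likelihood_pdf (lik uw.2) v.1 / G uw.1 uw.2) by exact: smoothP.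
apply/funext => -[u w]; apply/funext => -[[x' z'] [x z]].
rewrite (smoothed_pdfE T0 (F_qrP (y (u, w)))).
by apply: (congr2 (fun a b => a / b)); [rewrite y1 y2 yk|].
Qed.
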